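(* Let $\mathcal{C}_{\mathbb{A}_n}$ be the cluster category of the linearly oriented quiver $\mathbb{A}_n:n\to n-1\to\cdots\to1$, and let $(i,j)=\tau^{-i}P_j$ where $1\le j\le n$ and $0\le i\le n-j$. Then: (i) $$X_{(i,j)}X_{(i+j,1)}=X_{(i,j+1)}+X_{(i,j-1)}\,z_{i+j}\,y_{i+j+1}.$$ (ii) For $0\le\beta\le i$ and $\alpha\ge1$ with $i+j+\alpha\le n+1$, $$X_{(i-\beta,j+\beta)}X_{(i+1,j+\alpha-1)}=X_{(i+1,j-1)}X_{(i-\beta,j+\alpha+\beta)}+X_{(i-\beta,\beta)}X_{(i+j+1,\alpha-1)}\,z^{u}y^{v},$$ where $u=\dim(i-\beta,j+\beta)-\dim(i-\beta,\beta)$ and $v=\dim(i+1,j+\alpha-1)-\dim(i+j+1,\alpha-1)$. (iii) $X_{(i,j)}$ is the determinant of a $j\times j$ tridiagonal matrix: $$X_{(i,j)}=\left|\begin{array}{ccccc}X_{(i,1)}&y_{i+2}&0&\cdots&0\\ z_{i+1}&X_{(i+1,1)}&y_{i+3}&\cdots&0\\ 0&z_{i+2}&\ddots&&\vdots\\ \vdots&&&&y_{i+j}\\ 0&\cdots&0&z_{i+j-1}&X_{(i+j-1,1)}\end{array}\right|$$ (diagonal entries $X_{(i,1)},\dots,X_{(i+j-1,1)}$, superdiagonal entries $y_{i+2},\dots,y_{i+j}$, subdiagonal entries $z_{i+1},\dots,z_{i+j-1}$).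
   Context: Let $k$ be an algebraically closed field. $\mathcal{C}_Q$ is the cluster category of an acyclic quiver $Q$ with vertices $1,\dots,n$, the orbit category of $\mathcal{D}^b(\mathrm{mod}\,kQ)$ by $\tau^{-1}[1]$, with Auslander–Reiten translation $\tau$ and shift $[1]$. $P_j$ is the indecomposable projective module at vertex $j$; for $\mathbb{A}_n$ as in the claim, $P_1$ is simple. The indecomposable objects of $\mathcal{C}_{\mathbb{A}_n}$ are indexed as $(i,j)=\tau^{-i}P_j$ with $1\le j\le n$ and $0\le i\le n-j+1$; for $i+j\le n$ the object $(i,j)$ is the indecomposable module with support $\{i+1,\dots,i+j\}$ (in particular $(i,1)=S_{i+1}$, the simple module at $i+1$), while $(n-j+1,j)=P_{n-j+1}[1]$. By convention $(i,0)=0$. $\dim$ denotes the dimension vector. The cluster character with coefficients $X_?:\mathrm{obj}\,\mathcal{C}_Q\to\mathbb{Q}(x_1,\dots,x_n,y_1,\dots,y_n,z_1,\dots,z_n)$ is the map with $X_{M\oplus N}=X_MX_N$ (so $X_0=1$), $X_{P_i[1]}=x_i$, and, for an indecomposable $kQ$-module $V$ with dimension vector $d=(d_1,\dots,d_n)$, $$X_V=\sum_{0\le e\le d}\chi(\mathrm{Gr}_e(V))\prod_{r=1}^n x_r^{-\langle e,\alpha_r\rangle-\langle\alpha_r,d-e\rangle}\,y_r^{e_r}z_r^{d_r-e_r},$$ where $\mathrm{Gr}_e(V)$ is the Grassmannian of submodules of $V$ of dimension vector $e$, $\chi$ the Euler characteristic, $\alpha_r$ the dimension vector of the simple $S_r$,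 and $\langle\ ,\ \rangle$ the Euler form. For an integer vector $v$, $y^v=\prod_ry_r^{v_r}$ and $z^v=\prod_rz_r^{v_r}$.
   Formalization: In (i) the case i+j=n is left out: y_{n+1} is undefined and no value makes the formula true. In (ii) the case i+j+α=n+1 is left out: (i+1,j+α−1) is a shifted projective, so v is undefined, and no v works (e.g. n=2, i=j=α=1, β=0). *)

(* Defs.v *)
From HB Require Import structures.
From mathcomp Require Import all_boot all_order all_algebra.
From mathcomp Require Export fraction.
From mathcomp Require Export mpoly.

Set Implicit Arguments.
Unset Strict Implicit.
Unset Printing Implicit Defensive.

Import GRing.Theory.
Local Open Scope ring_scope.

Record quiver (n : nat) := Quiver {
  arrow : finType;
  src : arrow -> 'I_n;
  tgt : arrow -> 'I_n }.

(* The vertex written m in 1, ..., n is the ordinal of value m.-1.  The arrows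
   of the linear quiver n -> n-1 -> ... -> 1 are the pairs (r + 1, r). *)
Definition linear_quiver (n : nat) : quiver n :=
  @Quiver n {p : 'I_n * 'I_n | p.1 == p.2.+1 :> nat}
    (fun a => (val a).1) (fun a => (val a).2).

(* Elements of a representation are row vectors: an arrow a sends v in M_(src a)
   to v *m rmap M a in M_(tgt a).  With this convention the projective P_j of
   the linear quiver has support {1, ..., j}. *)
Record rep (k : fieldType) (n : nat) (Q : quiver n) := Rep {
  dimv : 'I_n -> nat;
  rmap : forall a : arrow Q, 'M[k]_(dimv (src a), dimv (tgt a)) }.

Section Representations.
Variables (k : fieldType) (n : nat) (Q : quiver n).
Implicit Types M N E : rep k Q.

Definition family M N := forall r : 'I_n, 'M[k]_(dimv M r, dimv N r).

Definition is_hom M N (f : family M N) : Prop :=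
  forall a : arrow Q, rmap M a *m f (tgt a) = f (src a) *m rmap N a.

Definition rep_iso M N : Prop :=
  exists (f : family M N) (g : family N M),
    [/\ is_hom f, is_hom g,
        forall r, f r *m g r = 1%:M & forall r, g r *m f r = 1%:M].

Definition rep_zero : rep k Q := @Rep k n Q (fun=> 0%N) (fun=> 0).

Definition rep_sum M N : rep k Q :=
  @Rep k n Q (fun r => (dimv M r + dimv N r)%N)
    (fun a => block_mx (rmap M a) 0 0 (rmap N a)).

Definition rep_simple (j : 'I_n) : rep k Q :=
  @Rep k n Q (fun r => (r == j : nat)) (fun=> 0).

Definition indecomposable M : Prop :=
  ~ rep_iso M rep_zero /\
  forall A B, rep_iso M (rep_sum A B) ->
    rep_iso A rep_zero \/ rep_iso B rep_zero.

Definition is_mono M N (f : family M N) : Prop :=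
  is_hom f /\ forall r, row_free (f r).

Definition is_epi M N (f : family M N) : Prop :=
  is_hom f /\ forall r, row_full (f r).

Definition projective (P : rep k Q) : Prop :=
  forall M N (p : family M N) (f : family P N), is_epi p -> is_hom f ->
    exists g : family P M, is_hom g /\ forall r, g r *m p r = f r.

Definition injective_rep (I : rep k Q) : Prop :=
  forall M N (i : family M N) (f : family M I), is_mono i -> is_hom f ->
    exists g : family N I, is_hom g /\ forall r, i r *m g r = f r.

(* P is (isomorphic to) P_j: the indecomposable projective with top S_j. *)
Definition is_proj_at (j : 'I_n) (P : rep k Q) : Prop :=
  [/\ indecomposable P, projective P &
      exists p : family P (rep_simple j), is_epi p].

(* I is (isomorphic to) I_j: the indecomposable injective with socle S_j. *)
Definition is_inj_at (j : 'I_n) (I : rep k Q) : Prop :=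
  [/\ indecomposable I, injective_rep I &
      exists i : family (rep_simple j) I, is_mono i].

Definition is_section M N (f : family M N) : Prop :=
  is_hom f /\
  exists g : family N M, is_hom g /\ forall r, f r *m g r = 1%:M.

Definition is_retraction M N (g : family M N) : Prop :=
  is_hom g /\
  exists f : family N M, is_hom f /\ forall r, f r *m g r = 1%:M.

(* 0 -> N -f-> E -g-> M -> 0 is an almost split (Auslander-Reiten) sequence. *)
Definition almost_split N E M (f : family N E) (g : family E M) : Prop :=
  [/\ indecomposable N /\ indecomposable M,
      [/\ is_mono f, is_epi g & forall r, (f r == kermx (g r))%MS],
      ~ is_section f /\ ~ is_retraction g,
      forall Y (h : family N Y), is_hom h -> ~ is_section h ->
        exists h' : family E Y, is_hom h' /\ forall r, f r *m h' r = h r &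
      forall Y (h : family Y M), is_hom h -> ~ is_retraction h ->
        exists h' : family Y E, is_hom h' /\ forall r, h' r *m g r = h r].

End Representations.

(* Every object of the orbit category of D^b(mod kQ) by tau^-1[1] (Q acyclic)
   is isomorphic to M + sum_r P_r[1]^(m_r) for a kQ-module M, unique up to
   isomorphism, and a unique multiplicity vector m; it is encoded as (M, m). *)
Record cobj (k : fieldType) (n : nat) (Q : quiver n) := CObj {
  cmod : rep k Q;
  cshift : {ffun 'I_n -> nat} }.

Section ClusterCategory.
Variables (k : fieldType) (n : nat) (Q : quiver n).
Implicit Types M N : cobj k Q.

Definition of_mod (V : rep k Q) : cobj k Q := CObj V [ffun=> 0%N].

Definition proj_shift (r : 'I_n) : cobj k Q :=
  CObj (rep_zero k Q) [ffun s => (s == r : nat)].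

Definition czero : cobj k Q := of_mod (rep_zero k Q).

Definition csum M N : cobj k Q :=
  CObj (rep_sum (cmod M) (cmod N)) [ffun r => (cshift M r + cshift N r)%N].

Definition ciso M N : Prop :=
  rep_iso (cmod M) (cmod N) /\ cshift M = cshift N.

Definition is_module M : Prop := cshift M = [ffun=> 0%N].

(* Meaningful when is_module M holds. *)
Definition cdim M : 'I_n -> nat := dimv (cmod M).

(* is_tau M N: M is indecomposable and N is isomorphic to tau M.  On
   non-projective modules tau is given by the almost split sequences of mod kQ.
   Since tau = [1] in the cluster category, tau P_r = P_r[1] and
   tau (P_r[1]) = nu P_r = I_r, with nu = tau[1] the Nakayama functor. *)
Inductive is_tau : cobj k Q -> cobj k Q -> Prop :=
| tau_nonproj (V W E : rep k Q) (f : family W E) (g : family E V) :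
    almost_split f g -> is_tau (of_mod V) (of_mod W)
| tau_proj (r : 'I_n) (P : rep k Q) :
    is_proj_at r P -> is_tau (of_mod P) (proj_shift r)
| tau_shift (r : 'I_n) (I : rep k Q) :
    is_inj_at r I -> is_tau (proj_shift r) (of_mod I).

(* T i j is (i, j) = tau^-i P_j for 1 <= j <= n and 0 <= i <= n - j + 1, and
   (i, 0) = 0; T is unconstrained at the other indices.  The ordinal j below
   is the vertex j.+1. *)
Record tau_orbit_indexing (T : nat -> nat -> cobj k Q) : Prop := {
  indexing_proj : forall j : 'I_n,
    exists2 P : rep k Q, is_proj_at j P & ciso (T 0%N j.+1) (of_mod P);
  indexing_tau : forall i j : nat, (1 <= j <= n)%N -> (i.+1 <= n - j + 1)%N ->
    exists M N, [/\ ciso (T i.+1 j) M, ciso (T i j) N & is_tau M N];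
  indexing_zero : forall i : nat, ciso (T i 0%N) czero }.

End ClusterCategory.

Section EulerCharacteristic.
Variable k : fieldType.

(* The affine space of dimension #|I|, with coordinates indexed by I. *)
Definition affine (I : finType) := {ffun I -> k}.

Definition peval (I : finType) (p : {mpoly k[#|I|]}) (x : affine I) : k :=
  p.@[fun t => x (enum_val t)].

Definition pmap (I J : finType) (f : J -> {mpoly k[#|I|]}) (x : affine I) :
  affine J := [ffun j => peval (f j) x].

Inductive constructible (I : finType) : (affine I -> Prop) -> Prop :=
| constructible_zeros (p : {mpoly k[#|I|]}) :
    constructible (fun x => peval p x = 0)
| constructible_compl A : constructible A -> constructible (fun x => ~ A x)
| constructible_inter A B : constructible A -> constructible B ->
    constructible (fun x => A x /\ B x)
| constructible_ext A B : (forall x, A x <-> B x) ->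
    constructible A -> constructible B.

Definition fst_part (I J : finType) (x : affine (I + J)%type) : affine I :=
  [ffun i => x (inl i)].
Definition snd_part (I J : finType) (x : affine (I + J)%type) : affine J :=
  [ffun j => x (inr j)].

(* The l-adic Euler characteristic (with compact support, which for varieties
   over an algebraically closed field equals the ordinary one), extended to
   constructible sets by additivity, has these properties.  In characteristic p
   it is not compatible with arbitrary fibrations, so only products appear. *)
Record euler_characteristic
    (chi : forall I : finType, (affine I -> Prop) -> int) : Prop := {
  chi_additive : forall (I : finType) (A B : affine I -> Prop),
    constructible A -> constructible B -> (forall x, A x -> ~ B x) ->
    chi I (fun x => A x \/ B x) = chi I A + chi I B;
  chi_isomorphism : forall (I J : finType)
      (A : affine I -> Prop) (B : affine J -> Prop)
      (f : J -> {mpoly k[#|I|]}) (g : I -> {mpoly k[#|J|]}),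
    constructible A -> constructible B ->
    (forall x, A x -> B (pmap f x) /\ pmap g (pmap f x) = x) ->
    (forall y, B y -> A (pmap g y) /\ pmap f (pmap g y) = y) ->
    chi I A = chi J B;
  chi_product : forall (I J : finType)
      (A : affine I -> Prop) (B : affine J -> Prop),
    constructible A -> constructible B ->
    chi (I + J)%type (fun x => A (fst_part x) /\ B (snd_part x)) =
    chi I A * chi J B;
  chi_line : chi unit (fun=> True) = 1 }.

(* Each subspace of k^d is the row space of exactly one square matrix in this
   form (the reduced echelon form, the row with pivot i being placed at index
   i).  The matrices with a given set of pivots form an affine space that is
   isomorphic to a Schubert cell of the Grassmannian. *)
Definition reduced_echelon (d : nat) (A : 'M[k]_d) : Prop :=
  forall i, (forall j, A i j = 0) \/
    [/\ A i i = 1, forall j : 'I_d, (j < i)%N -> A i j = 0 &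
        forall l, l != i -> A l i = 0].

Variables (n : nat) (Q : quiver n).

Definition entry_index (V : rep k Q) : finType :=
  {r : 'I_n & ('I_(dimv V r) * 'I_(dimv V r))%type}.

Definition subspace_at (V : rep k Q) (x : affine (entry_index V)) (r : 'I_n) :
    'M[k]_(dimv V r) :=
  \matrix_(i, j) x (existT _ r (i, j)).

(* Gr_e(V), cut into the pieces given by the products of Schubert cells;
   by additivity the Euler characteristic does not see this cutting. *)
Definition quiver_grassmannian (V : rep k Q) (e : 'I_n -> nat) :
    affine (entry_index V) -> Prop :=
  fun x =>
    (forall r, reduced_echelon (subspace_at x r) /\
               \rank (subspace_at x r) = e r) /\
    forall a : arrow Q,
      (subspace_at x (src a) *m rmap V a <= subspace_at x (tgt a))%MS.

End EulerCharacteristic.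

(* Q(x_1, ..., x_n, y_1, ..., y_n, z_1, ..., z_n) *)
Definition coef_field (n : nat) : fieldType := {fraction {mpoly rat[n + n + n]}}.

Definition xvar (n : nat) (r : 'I_n) : coef_field n :=
  tofrac ('X_(lshift n (lshift n r)) : {mpoly rat[n + n + n]}).
Definition yvar (n : nat) (r : 'I_n) : coef_field n :=
  tofrac ('X_(lshift n (rshift n r)) : {mpoly rat[n + n + n]}).
Definition zvar (n : nat) (r : 'I_n) : coef_field n :=
  tofrac ('X_(rshift (n + n) r) : {mpoly rat[n + n + n]}).

Definition monomial (n : nat) (F : 'I_n -> coef_field n) (v : 'I_n -> int) :
  coef_field n := \prod_(r < n) F r ^ v r.

(* F at the vertex m of 1, ..., n; the value 0 at other m is never used. *)
Definition at_vertex (n : nat) (F : 'I_n -> coef_field n) (m : nat) :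
  coef_field n := if [pick r : 'I_n | r.+1 == m] is Some r then F r else 0.

Definition euler_form (n : nat) (Q : quiver n) (d e : 'I_n -> int) : int :=
  \sum_(r < n) d r * e r - \sum_(a : arrow Q) d (src a) * e (tgt a).

Definition simple_dim (n : nat) (r : 'I_n) : 'I_n -> int :=
  fun s => (s == r : nat)%:Z.

Section ClusterCharacter.
Variables (k : fieldType) (n : nat) (Q : quiver n).
Variable chi : forall I : finType, (affine k I -> Prop) -> int.

Definition character_formula (V : rep k Q) : coef_field n :=
  \sum_(e : {dffun forall r : 'I_n, 'I_(dimv V r).+1})
    let e' (r : 'I_n) : int := (e r : nat)%:Z in
    let f' (r : 'I_n) : int := (dimv V r)%:Z - e' r in
    (chi (quiver_grassmannian (V := V) (fun r => e r : nat)))%:~R *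
    \prod_(r < n)
      (xvar r ^ (- euler_form Q e' (simple_dim r)
                 - euler_form Q (simple_dim r) f')
       * yvar r ^ e' r * zvar r ^ f' r).

Record cluster_character (X : cobj k Q -> coef_field n) : Prop := {
  character_iso : forall M N, ciso M N -> X M = X N;
  character_sum : forall M N, X (csum M N) = X M * X N;
  character_zero : X (czero k Q) = 1;
  character_shift : forall r, X (proj_shift k Q r) = xvar r;
  character_module : forall V, indecomposable V ->
    X (of_mod V) = character_formula V }.

End ClusterCharacter.

(* Main.v *)
Require Import Defs.
From mathcomp Require Import all_boot all_order all_algebra.
From mathcomp Require Import ring zify.
Import Defs.
Set Implicit Arguments.
Unset Strict Implicit.
Unset Printing Implicit Defensive.
Import GRing.Theory.
Local Open Scope ring_scope.

(** The object (i, j) with i + j <= n is the interval module whose support is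
    the i-th to (i+j-1)-st vertex, counted from 0, and such a module is
    uniserial: its submodules are the initial subintervals.  So each nonempty
    quiver Grassmannian is a point, and the character of the interval [a, b) is
    x_(a-1) x_b times the sum over a <= m <= b of
    y_a ... y_(m-1) z_m ... z_(b-1) / (x_(m-1) x_m),
    with x_(-1) = x_n = 1 ([character_formula_interval]).  Cutting that sum at
    an index c writes the sum of [a, b) in terms of those of [a, c] and
    [c+1, b) ([interval_sum_split]).  Three such cuts turn (ii) into an identity
    of commutative algebra in which the boundary variables cancel
    ([interval_char_exchange]); (i) is the case of a simple second factor, and
    it is the recurrence satisfied by the continuants in (iii)
    ([det_tridiagonal_rec]).

    The substance is the identification of the objects (i, j) from abstract
    Auslander-Reiten data.  All identifications use one principle: if an
    indecomposable V admits maps C -> V -> C with composite 1 and C nonzero,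
    then V is isomorphic to C ([indecomposable_retract]).  A map out of an
    interval amounts to a vector at its upper end and a map into an interval
    to a functional at its lower end, so such maps are easily produced.  This
    gives that P_j is the interval [0, j) and that the injective I_j is
    [j-1, n).  For an almost split sequence W -> E -> V with W = [a, b) and
    b < n, it shows V = [a+1, b+1), without classifying representations: the
    maps from W to [a, b+1) and to [a+1, b) extend to E because they are not
    sections, which yields V -> [a+1, b+1), and a map in the other direction
    exists because otherwise W -> E would be a section
    ([almost_split_interval]).  Induction on i then identifies all (i, j). *)

(** * Retracts of indecomposable representations *)

Section AnyQuiver.
Variables (k : fieldType) (n : nat) (Q : quiver n).
Implicit Types M N L V C : rep k Q.

Lemma hom_comp M N L (f : family M N) (g : family N L) :
  is_hom f -> is_hom g -> is_hom (M := M) (N := L) (fun r => f r *m g r).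
Proof. by move=> hf hg a; rewrite mulmxA hf -!mulmxA hg. Qed.

Lemma rep_iso_sym M N : rep_iso M N -> rep_iso N M.
Proof. by case=> f [g [? ? ? ?]]; exists g, f. Qed.

Lemma rep_iso_trans N M L : rep_iso M N -> rep_iso N L -> rep_iso M L.
Proof.
move=> [f [f' [hf hf' ff' f'f]]] [g [g' [hg hg' gg' g'g]]].
exists (fun r => f r *m g r), (fun r => g' r *m f' r); split.
- exact: hom_comp.
- exact: hom_comp.
- by move=> r; rewrite mulmxA -(mulmxA (f r)) gg' mulmx1.
- by move=> r; rewrite mulmxA -(mulmxA (g' r)) f'f mulmx1.
Qed.

Lemma rep_iso_dim M N : rep_iso M N -> forall r, dimv M r = dimv N r.
Proof.
move=> [f [g [_ _ fg gf]]] r; apply/eqP; rewrite eqn_leq; apply/andP; split.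
- by rewrite -{1}(mxrank1 k (dimv M r)) -fg (leq_trans (mxrankM_maxr _ _)) ?rank_leq_row.
- by rewrite -{1}(mxrank1 k (dimv N r)) -gf (leq_trans (mxrankM_maxr _ _)) ?rank_leq_row.
Qed.

Lemma indecomposable_iso M N : rep_iso M N -> indecomposable M -> indecomposable N.
Proof.
move=> isoMN [M0 Mdec]; split; first by move/(rep_iso_trans isoMN).
by move=> A B /(rep_iso_trans isoMN)/Mdec.
Qed.

(** The idempotent [1 - p s] of [V] splits, its image being a complement of the
    summand [C]; that complement vanishes because [V] is indecomposable. *)
Lemma indecomposable_retract V C (s : family C V) (p : family V C) :
    indecomposable V -> ~ rep_iso C (rep_zero k Q) ->
    is_hom s -> is_hom p -> (forall r, s r *m p r = 1%:M) ->
  rep_iso V C.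
Proof.
move=> [_ Vdec] C0 hs hp sp.
pose e r := 1%:M - p r *m s r.
pose P r := col_base (e r); pose R r := row_base (e r).
have PR r : P r *m R r = e r by exact: mulmx_base.
have se r : s r *m e r = 0 by rewrite mulmxBr mulmx1 mulmxA sp mul1mx subrr.
have ep r : e r *m p r = 0 by rewrite mulmxBl mul1mx -mulmxA sp mulmx1 subrr.
have ee r : e r *m e r = e r by rewrite {2}/e mulmxBr mulmx1 mulmxA ep mul0mx subr0.
have Rfree r : row_free (R r) by exact: row_base_free.
have Pfull r : row_full (P r) by exact: col_base_full.
clearbody P R.
have sP r : s r *m P r = 0.
  by apply: (row_free_inj (Rfree r)); rewrite mul0mx -mulmxA PR se.
have Rp r : R r *m p r = 0.
  by apply: (row_full_inj (Pfull r)); rewrite mulmx0 mulmxA PR ep.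
have RP r : R r *m P r = 1%:M.
  apply: (row_full_inj (Pfull r)); apply: (row_free_inj (Rfree r)).
  by rewrite mulmx1 mulmxA PR -mulmxA PR ee.
have eP r : e r *m P r = P r.
  by transitivity (P r *m R r *m P r); [rewrite PR | rewrite -mulmxA RP mulmx1].
have Re r : R r *m e r = R r.
  by transitivity (R r *m (P r *m R r)); [rewrite PR | rewrite mulmxA RP mul1mx].
have he a : rmap V a *m e (tgt a) = e (src a) *m rmap V a.
  by rewrite mulmxBr mulmxBl mulmx1 mul1mx mulmxA hp -!mulmxA hs.
pose K := @Rep k n Q (fun r => \rank (e r))
  (fun a : arrow Q => R (src a) *m rmap V a *m P (tgt a)).
have hP a : rmap V a *m P (tgt a) = P (src a) *m (R (src a) *m rmap V a *m P (tgt a)).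
  by rewrite !mulmxA PR -he -mulmxA eP.
have hR a : R (src a) *m rmap V a *m P (tgt a) *m R (tgt a) = R (src a) *m rmap V a.
  by rewrite -mulmxA PR -mulmxA he mulmxA Re.
have VCK : rep_iso V (rep_sum C K).
  exists (fun r => row_mx (p r) (P r)), (fun r => col_mx (s r) (R r)); split.
  - move=> a /=; rewrite mul_mx_row mul_row_block !mulmx0 addr0 add0r hp.
    by congr row_mx; exact: hP.
  - move=> a /=; rewrite mul_block_col mul_col_mx !mul0mx addr0 add0r hs.
    by congr col_mx; exact: hR.
  - by move=> r; rewrite mul_row_col PR /e addrC subrK.
  - by move=> r; rewrite mul_col_row sp sP Rp RP -scalar_mx_block.
case: (Vdec _ _ VCK) => // /rep_iso_dim K0.
exists p, s; split=> // r; apply/esym/eqP; rewrite -subr_eq0 -mxrank_eq0.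
by apply/eqP; exact: K0.
Qed.

End AnyQuiver.

(** * Transport along the paths of the linear quiver *)

Section Linear.
Variables (k : fieldType) (n : nat).
Local Notation An := (linear_quiver n).
Implicit Types (M N Y V : rep k An) (a b : nat) (r s t p : 'I_n).

Lemma srcE (ar : arrow An) : src ar = (tgt ar).+1 :> nat.
Proof. by case: ar => p /= /eqP. Qed.

Lemma arrow_to t : (t.+1 < n)%N -> exists ar : arrow An, tgt ar = t.
Proof.
move=> lt_tn; have e : (Ordinal lt_tn, t).1 == (Ordinal lt_tn, t).2.+1 :> nat by [].
by exists (exist (fun p : 'I_n * 'I_n => p.1 == p.2.+1 :> nat) _ e).
Qed.

Lemma arrow_from s : (0 < s)%N -> exists ar : arrow An, src ar = s.
Proof.
move=> s0; have lt_n : (s.-1 < n)%N by rewrite (leq_ltn_trans (leq_pred s)).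
have [|ar e] := @arrow_to (Ordinal lt_n); first by rewrite /= prednK.
by exists ar; apply: val_inj; rewrite /= srcE e /= prednK.
Qed.

Lemma ltn_neq_ord r s : (r < s)%N -> r != s.
Proof. by apply: contraTneq => ->; rewrite ltnn. Qed.

Lemma tgt_inj : injective (@tgt n An).
Proof.
move=> x y exy; apply: val_inj.
have exy1 : src x = src y by apply: val_inj; rewrite /= !srcE exy.
by rewrite /= [LHS]surjective_pairing [RHS]surjective_pairing; congr pair.
Qed.

Lemma arrow_down (P : 'I_n -> Prop) p : P p ->
  (forall ar : arrow An, src ar <= p -> P (src ar) -> P (tgt ar))%N ->
  forall r, (r <= p)%N -> P r.
Proof.
move=> Pp IH r lerp; have [d] := ubnP (p - r); elim: d r lerp => // d IHd r lerp lepd.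
have [erp|nerp] := eqVneq r p; first by rewrite erp.
have ltrp : (r < p)%N by rewrite ltn_neqAle nerp.
have [|ar e] := @arrow_to r; first exact: leq_ltn_trans (ltn_ord p).
rewrite -e; apply: IH; rewrite ?srcE ?e //; apply: IHd; rewrite srcE e //.
by rewrite subnS; case: (p - r)%N lepd (subn_gt0 r p); rewrite ltrp // => m.
Qed.

Lemma arrow_up (P : 'I_n -> Prop) p : P p ->
  (forall ar : arrow An, p <= tgt ar -> P (tgt ar) -> P (src ar))%N ->
  forall r, (p <= r)%N -> P r.
Proof.
move=> Pp IH r; have [d] := ubnP r; elim: d r => // d IHd r ltrd lepr.
have [erp|nerp] := eqVneq r p; first by rewrite erp.
have ltrp : (p < r)%N by rewrite ltn_neqAle eq_sym nerp.
have [|ar e] := @arrow_from r; first exact: leq_ltn_trans ltrp.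
have er : r = (tgt ar).+1 :> nat by rewrite -srcE e.
rewrite -e; apply: IH; first by rewrite -ltnS -er.
by apply: IHd; rewrite -ltnS -er.
Qed.

(** The rows of [w0] are vectors at [p], and [W r] holds their images along the
    path from [p] to [r].  For [w0] the identity, [W r] is the map of that path;
    this is why a matrix is pushed rather than a single vector. *)
Lemma push_forward Y p m (w0 : 'M[k]_(m, dimv Y p)) :
  exists2 W : forall r, 'M[k]_(m, dimv Y r), W p = w0 &
    forall ar : arrow An, (src ar <= p)%N -> W (src ar) *m rmap Y ar = W (tgt ar).
Proof.
have [d lepd] := ubnP p.
suff [W Wp Wm] : exists2 W : forall r, 'M[k]_(m, dimv Y r), W p = w0 &
    forall ar : arrow An, (src ar <= p)%N -> (p <= tgt ar + d)%N ->
      W (src ar) *m rmap Y ar = W (tgt ar).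
  by exists W => // ar lep; apply: Wm => //; rewrite (leq_trans (ltnW lepd)) ?leq_addl.
elim: d {lepd} => [|d [W Wp Wm]].
  exists (dfwith (T := fun r => 'M[k]_(m, dimv Y r)) (fun r => 0) w0).
    by rewrite dfwith_in.
  by move=> ar; rewrite srcE addn0 => /leq_trans H /H; rewrite ltnn.
have [ltdp|ledp] := ltnP d p; last first.
  exists W => // ar lep _; apply: Wm => //.
  by rewrite (leq_trans ledp) ?leq_addl.
have lt_n : (p - d.+1 < n)%N by rewrite (leq_ltn_trans (leq_subr _ _)).
have [|ar0 e0] := @arrow_to (Ordinal lt_n).
  by rewrite /= -subSn // subSS (leq_ltn_trans (leq_subr _ _)).
have vt0 : tgt ar0 = (p - d.+1)%N :> nat by rewrite e0.
exists (dfwith (T := fun r => 'M[k]_(m, dimv Y r)) W (W (src ar0) *m rmap Y ar0)).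
  by rewrite dfwith_out //; apply: ltn_neq_ord; rewrite vt0 -subn_gt0 subKn.
move=> ar lep ltp; have [ear|near] := eqVneq ar ar0.
  by rewrite ear dfwith_in dfwith_out //; apply: ltn_neq_ord; rewrite srcE.
have lt0 : (tgt ar0 < tgt ar)%N.
  rewrite ltn_neqAle vt0 leq_subLR addnC ltp andbT -vt0.
  by apply: contra near => /eqP/val_inj/tgt_inj ->.
rewrite !dfwith_out; [|exact: ltn_neq_ord|by apply: ltn_neq_ord; rewrite srcE ltnS ltnW].
apply: Wm => //; rewrite addnC -leq_subLR; move: lt0; rewrite vt0 subnS.
by case: (p - d)%N.
Qed.

(** Dually, the columns of [l0] are functionals at [p], composed here with the
    paths that end at [p]. *)
Lemma pull_back Y p m (l0 : 'M[k]_(dimv Y p, m)) :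
  exists2 L : forall r, 'M[k]_(dimv Y r, m), L p = l0 &
    forall ar : arrow An, (p <= tgt ar)%N -> rmap Y ar *m L (tgt ar) = L (src ar).
Proof.
suff {}/(_ n) [L Lp Lm] d : exists2 L : forall r, 'M[k]_(dimv Y r, m), L p = l0 &
    forall ar : arrow An, (p <= tgt ar)%N -> (tgt ar < p + d)%N ->
      rmap Y ar *m L (tgt ar) = L (src ar).
  by exists L => // ar lep; apply: Lm => //; rewrite (leq_trans (ltn_ord _)) ?leq_addl.
elim: d => [|d [L Lp Lm]].
  exists (dfwith (T := fun r => 'M[k]_(dimv Y r, m)) (fun r => 0) l0).
    by rewrite dfwith_in.
  by move=> ar; rewrite addn0 => /leq_ltn_trans H /H; rewrite ltnn.
have [ltdn|ledn] := ltnP (p + d).+1 n; last first.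
  exists L => // ar lep _; apply: Lm => //.
  by rewrite -ltnS -srcE (leq_trans (ltn_ord _)).
have [|ar0 e0] := @arrow_from (Ordinal ltdn) => //.
have vs0 : tgt ar0 = (p + d)%N :> nat by apply: succn_inj; rewrite -srcE e0.
exists (dfwith (T := fun r => 'M[k]_(dimv Y r, m)) L (rmap Y ar0 *m L (tgt ar0))).
  by rewrite dfwith_out // eq_sym; apply: ltn_neq_ord; rewrite srcE vs0 ltnS leq_addr.
move=> ar lep ltp; have [ear|near] := eqVneq ar ar0.
  by rewrite ear dfwith_in dfwith_out // eq_sym; apply: ltn_neq_ord; rewrite srcE.
have lt0 : (tgt ar < p + d)%N.
  rewrite ltn_neqAle -ltnS -addnS ltp andbT -vs0.
  by apply: contra near => /eqP/val_inj/tgt_inj ->.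
rewrite !dfwith_out ?Lm //; rewrite eq_sym; apply: ltn_neq_ord; rewrite !srcE vs0 ltnS //.
exact: ltnW.
Qed.

End Linear.

(** * Interval modules *)

Lemma ord_bool (d : bool) : 'I_d -> d.
Proof. by case: d => // -[]. Qed.

Section Ones.
Variable k : fieldType.

Lemma ones_mul m c p : ((0 < m) -> (0 < p) -> c = 1)%N ->
  (const_mx 1 : 'M[k]_(m, c)) *m (const_mx 1 : 'M_(c, p)) = const_mx 1.
Proof.
move=> c1; apply/matrixP=> i j; rewrite !mxE.
have -> : c = 1%N.
  by apply: c1; [exact: leq_ltn_trans (ltn_ord i) | exact: leq_ltn_trans (ltn_ord j)].
by rewrite big_ord1 !mxE mulr1.
Qed.

(** A space whose dimension is the value of a boolean factors through the ground
    field, so that no cast on dimensions is needed. *)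
Lemma ones_id (d : bool) :
  (const_mx 1 : 'M[k]_(d, 1)) *m (const_mx 1 : 'M_(1, d)) = 1%:M.
Proof.
rewrite ones_mul //; apply/matrixP; case: d => [] [] [] //= i [] [] // j.
by rewrite !mxE.
Qed.

Lemma ones_full (d : bool) : (const_mx 1 : 'M[k]_(d, d)) = 1%:M.
Proof. by rewrite -ones_id ones_mul. Qed.

Lemma row_vec_dual m (y : 'rV[k]_m) : y != 0 -> exists l : 'cV_m, y *m l = 1%:M.
Proof. by move=> y0; apply/row_freeP; rewrite /row_free rank_rV y0. Qed.

Lemma col_vec_dual m (l : 'cV[k]_m) : l != 0 -> exists y : 'rV_m, y *m l = 1%:M.
Proof.
move=> l0; have [|y e] := @row_vec_dual m l^T; first by rewrite trmx_eq0.
by exists y^T; apply: trmx_inj; rewrite trmx_mul trmxK e trmx1.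
Qed.

Lemma separating_functional m q (y : 'rV[k]_m) (W : 'M_(q, m)) :
  ~~ (y <= W)%MS -> exists2 l : 'cV_m, y *m l = 1%:M & W *m l = 0.
Proof.
rewrite submxE => /row_vec_dual [l yl]; exists (cokermx W *m l).
  by rewrite mulmxA.
by rewrite mulmxA mulmx_coker mul0mx.
Qed.

End Ones.

Section Intervals.
Variables (k : fieldType) (n : nat).
Local Notation An := (linear_quiver n).
Implicit Types (M N Y V : rep k An) (a b : nat) (r s t p : 'I_n).

(** The support is {a+1, ..., b} in the numbering of vertices from 1, so that
    (i, j) is to be [interval_rep i (i + j)].  The matrix of ones is the identity
    between two vertices of the support, and is empty elsewhere. *)
Definition interval_rep a b : rep k An :=
  @Rep k n An (fun r => (a <= r < b)%N : nat) (fun=> const_mx 1).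

(** The quotient onto the common part followed by the inclusion of that part. *)
Definition interval_map a b a' b' : family (interval_rep a b) (interval_rep a' b') :=
  fun r => const_mx 1.

Lemma interval_map_hom a b a' b' : (a <= a')%N -> (b <= b')%N ->
  is_hom (@interval_map a b a' b').
Proof.
move=> leaa lebb ar; rewrite /interval_map /= !ones_mul // srcE.
  rewrite !lt0b => /andP[h1 h2] /andP[h3 h4]; rewrite (leqW h3) /=.
  by rewrite (leq_trans h2).
rewrite !lt0b => /andP[h1 h2] /andP[h3 h4]; rewrite (leq_trans leaa h3) /=.
by rewrite ltnW.
Qed.

Lemma interval_map_comp a b a' b' a'' b'' r : (a' <= a'')%N -> (b <= b')%N ->
  @interval_map a b a' b' r *m @interval_map a' b' a'' b'' r =
  @interval_map a b a'' b'' r.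
Proof.
move=> leaa lebb; rewrite /interval_map ones_mul //=.
rewrite !lt0b => /andP[h1 h2] /andP[h3 h4]; rewrite (leq_trans leaa h3) /=.
by rewrite (leq_trans h2).
Qed.

Lemma interval_nonzero a b : (a < b)%N -> (a < n)%N ->
  ~ rep_iso (interval_rep a b) (rep_zero k An).
Proof.
by move=> ltab ltan /rep_iso_dim/(_ (Ordinal ltan)); rewrite /= leqnn ltab.
Qed.

(** An interval module is generated at the vertex [b - 1]: a map out of it is a
    vector there together with its images, subject to dying below [a]. *)
Lemma vec_hom Y a b (w : forall r, 'rV[k]_(dimv Y r)) :
    (forall ar : arrow An, (a <= src ar < b)%N ->
      w (src ar) *m rmap Y ar = if (a <= tgt ar)%N then w (tgt ar) else 0) ->
  is_hom (M := interval_rep a b) (N := Y) (fun r => const_mx 1 *m w r).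
Proof.
move=> ww ar; apply/row_matrixP => i.
have si : (a <= src ar < b)%N by exact: ord_bool i.
rewrite -[in RHS]mulmxA ww //; case: ifP => [leat|ltat].
  have lttb : (tgt ar < b)%N by rewrite ltnW // -srcE; case/andP: si.
  by rewrite mulmxA ones_mul //= leat lttb.
rewrite mulmx0 mulmxA [rmap _ _ *m const_mx 1](_ : _ = 0) ?mul0mx //.
by apply/matrixP=> x y; rewrite !mxE big1 // => - [z]; rewrite /= ltat.
Qed.

(** An interval module is cogenerated at the vertex [a]: a map into it is a
    functional there, pulled back, subject to vanishing on what comes from [b]. *)
Lemma covec_hom Y a b (l : forall r, 'cV[k]_(dimv Y r)) :
    (forall ar : arrow An, (a <= tgt ar < b)%N ->
      rmap Y ar *m l (tgt ar) = if (src ar < b)%N then l (src ar) else 0) ->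
  is_hom (M := Y) (N := interval_rep a b) (fun r => l r *m const_mx 1).
Proof.
move=> ll ar; apply/matrixP => x i.
have ti : (a <= tgt ar < b)%N by exact: ord_bool i.
rewrite mulmxA ll //; case: ifP => [ltsb|gesb].
  have leas : (a <= src ar)%N by rewrite srcE leqW //; case/andP: ti.
  by rewrite -mulmxA ones_mul //= leas ltsb.
rewrite mul0mx -mulmxA [const_mx 1 *m rmap _ _](_ : _ = 0) ?mulmx0 //.
by apply/matrixP=> u v; rewrite !mxE big1 // => - [z]; rewrite /= gesb andbF.
Qed.

Lemma hom_vec Y a b (h : family (interval_rep a b) Y) : is_hom h ->
  forall ar : arrow An, (a <= src ar < b)%N ->
  (const_mx 1 : 'rV_(_)) *m h (src ar) *m rmap Y ar =
    (const_mx 1 : 'rV_(_)) *m h (tgt ar).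
Proof. by move=> hh ar si; rewrite -mulmxA -hh mulmxA ones_mul //= si. Qed.

Lemma hom_covec Y a b (h : family Y (interval_rep a b)) : is_hom h ->
  forall ar : arrow An, (a <= tgt ar < b)%N ->
  rmap Y ar *m (h (tgt ar) *m (const_mx 1 : 'cV_(_))) =
    h (src ar) *m (const_mx 1 : 'cV_(_)).
Proof. by move=> hh ar ti; rewrite mulmxA hh -mulmxA ones_mul //= ti. Qed.

(** The pairing of a pushed vector with a pulled functional is the functional
    evaluated on a path, wherever along the path it is computed. *)
Lemma pairing_const Y m m' a b (w : forall r, 'M[k]_(m, dimv Y r))
    (l : forall r, 'M[k]_(dimv Y r, m')) :
    (forall ar : arrow An, (a <= tgt ar)%N -> (src ar < b)%N ->
      w (src ar) *m rmap Y ar = w (tgt ar)) ->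
    (forall ar : arrow An, (a <= tgt ar)%N -> (src ar < b)%N ->
      rmap Y ar *m l (tgt ar) = l (src ar)) ->
  forall p r, (a <= p)%N -> (p <= r)%N -> (r < b)%N -> w r *m l r = w p *m l p.
Proof.
move=> hw hl p r leap; move: r; apply: arrow_up => // ar lept IH ltsb.
rewrite -hl ?mulmxA ?hw ?IH //; rewrite ?(leq_trans leap) //.
by rewrite -ltnS -srcE ltnW.
Qed.

(** The retraction is the map defined by a functional at the socle that takes the
    value 1 on the image of the socle.  It is well defined if that functional
    vanishes on the image of the path from [b] to [a]; for [b = n] there is no
    such path. *)
Lemma section_of_functional Y a b p (h : family (interval_rep a b) Y)
    (l0 : 'cV_(dimv Y p)) :
    is_hom h -> p = a :> nat -> const_mx 1 *m h p *m l0 = 1%:M ->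
    (forall q : 'I_n, q = b :> nat -> exists W : forall r, 'M_(dimv Y q, dimv Y r),
      [/\ W q = 1%:M, W p *m l0 = 0 &
      forall ar : arrow An, (src ar <= q)%N ->
        W (src ar) *m rmap Y ar = W (tgt ar)]) ->
  exists2 g : family Y (interval_rep a b), is_hom g & forall r, h r *m g r = 1%:M.
Proof.
move=> hh pa hl0 Wl0; have [L Lp Lm] := pull_back l0.
exists (fun r => L r *m const_mx 1).
  apply: covec_hom => ar /andP[leat lttb]; rewrite Lm ?pa //.
  case: ifP => // /negbT; rewrite -leqNgt => lebs.
  have sb : src ar = b :> nat by apply/eqP; rewrite eqn_leq lebs srcE lttb.
  have [W [Wq Wp Wm]] := Wl0 _ sb.
  rewrite -[LHS]mul1mx -Wq -Wp -Lp.
  apply: (@pairing_const Y _ _ a b.+1); rewrite ?pa ?srcE ?ltnS //.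
  - by move=> ar' _ le_b; apply: Wm; rewrite sb.
  - by move=> ar' leat' _; apply: Lm; rewrite pa.
  - exact: leqW.
move=> r; apply/row_matrixP => i.
have /andP[lear ltrb] : (a <= r < b)%N by exact: ord_bool i.
have key : const_mx 1 *m h r *m L r = 1%:M :> 'M_1.
  rewrite -hl0 -Lp.
  apply: (@pairing_const Y _ _ a b (fun r => const_mx 1 *m h r) L); rewrite ?pa //.
    by move=> ar leat ltsb; rewrite (hom_vec hh) // ltsb srcE leqW.
  by move=> ar leat ltsb; apply: Lm; rewrite pa.
have eh : h r = (const_mx 1 : 'cV_(_)) *m ((const_mx 1 : 'rV_(_)) *m h r).
  by rewrite mulmxA ones_id mul1mx.
by rewrite eh -mulmxA (mulmxA _ (L r)) key mul1mx ones_id.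
Qed.

(** Intervals that reach the source [n] of the quiver are injective, and a map
    out of one is injective as soon as it is nonzero on the socle. *)
Lemma interval_injective Y a p (h : family (interval_rep a n) Y) :
    is_hom h -> p = a :> nat -> h p != 0 ->
  exists2 g : family Y (interval_rep a n), is_hom g & forall r, h r *m g r = 1%:M.
Proof.
move=> hh pa hp0; have [|l hl] := @row_vec_dual k _ (const_mx 1 *m h p).
  apply: contra hp0 => /eqP e; apply/eqP.
  by rewrite -[h p]mul1mx -ones_id -mulmxA e mulmx0.
apply: (section_of_functional hh pa hl) => q qn.
by have := ltn_ord q; rewrite qn ltnn.
Qed.

(** Intervals that reach the sink are projective, and a map to one is surjective
    as soon as it is nonzero on the top. *)
Lemma interval_projective Y b p (h : family Y (interval_rep 0 b)) :
    is_hom h -> p.+1 = b -> h p != 0 ->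
  exists2 s : family (interval_rep 0 b) Y, is_hom s & forall r, s r *m h r = 1%:M.
Proof.
move=> hh pb hp0; have [|y hy] := @col_vec_dual k _ (h p *m const_mx 1).
  apply: contra hp0 => /eqP e; apply/eqP.
  by rewrite -[h p]mulmx1 -ones_id mulmxA e mul0mx.
have [W Wp Wm] := push_forward y.
exists (fun r => const_mx 1 *m W r).
  by apply: vec_hom => ar; rewrite -pb ltnS => lesp; exact: Wm.
move=> r; apply/matrixP => i x; have ltrb : (r < b)%N by case/andP: (ord_bool i).
move: i x; apply/matrixP.
have key : W r *m (h r *m const_mx 1) = 1%:M :> 'M_1.
  apply: esym; rewrite -hy -Wp.
  apply: (@pairing_const Y _ _ 0 b W (fun r => h r *m const_mx 1)); rewrite -?pb //.
    by move=> ar _; exact: Wm.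
    by move=> ar leat ltsb; rewrite (hom_covec hh) // leat ltnW // -srcE.
  by rewrite -ltnS pb.
have eh : h r = (h r *m (const_mx 1 : 'cV_(_))) *m (const_mx 1 : 'rV_(_)).
  by rewrite -mulmxA ones_id mulmx1.
by rewrite eh mulmxA -(mulmxA _ (W r)) key mulmx1 ones_id.
Qed.

End Intervals.

(** * Almost split sequences that start at an interval module *)

Section AR.
Variables (k : fieldType) (n : nat).
Local Notation An := (linear_quiver n).
Local Notation interval_rep := (interval_rep k n).
Local Notation interval_map := (@interval_map k n).
Implicit Types (M N Y V : rep k An) (a b : nat) (r s t p : 'I_n).

(** The epimorphism to the simple lifts to a map to the interval that is nonzero
    on the top, hence split. *)
Lemma proj_at_interval r (P : rep k An) : is_proj_at r P -> rep_iso P (interval_rep 0 r.+1).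
Proof.
move=> [Pind Pproj [p [hp pfull]]].
pose q : family (interval_rep 0 r.+1) (rep_simple k An r) := fun s => const_mx 1.
have epi_q : is_epi q.
  split=> [ar|s].
    rewrite mulmx0; apply/matrixP => i j; rewrite !mxE big1 // => l _.
    have /eqP et : tgt ar == r := ord_bool j; exfalso.
    by have /andP[_] := ord_bool i; rewrite srcE et ltnn.
  apply/row_fullP; exists (const_mx 1); rewrite ones_mul ?ones_full //=.
  by rewrite !lt0b => /eqP -> _; rewrite ltnSn.
have [g [hg gq]] := Pproj _ _ q p epi_q hp.
have gr0 : g r != 0.
  apply: contraTneq (pfull r) => e; rewrite -gq e mul0mx /row_full mxrank0 /=.
  by rewrite eqxx.
have [s hs sg] := interval_projective hg erefl gr0.
apply: (indecomposable_retract Pind _ hs hg sg).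
by apply: interval_nonzero => //; rewrite (leq_ltn_trans _ (ltn_ord r)).
Qed.

(** The inclusion of the simple extends to a map from the interval that is
    nonzero on the socle, hence split. *)
Lemma inj_at_interval r (I : rep k An) : is_inj_at r I -> rep_iso I (interval_rep r n).
Proof.
move=> [Iind Iinj [i [hi ifree]]].
pose q : family (rep_simple k An r) (interval_rep r n) := fun s => const_mx 1.
have mono_q : is_mono q.
  split=> [ar|s].
    rewrite mul0mx; apply/matrixP => x y; rewrite !mxE big1 // => l _.
    have /eqP es : src ar == r := ord_bool x; exfalso.
    by have /andP[+ _] := ord_bool y; rewrite -es srcE ltnn.
  apply/row_freeP; exists (const_mx 1); rewrite ones_mul ?ones_full //=.
  by rewrite !lt0b => /eqP -> _; rewrite leqnn ltn_ord.
have [g [hg qg]] := Iinj _ _ q i mono_q hi.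
have gr0 : g r != 0.
  apply: contraTneq (ifree r) => e; rewrite -qg e mulmx0 /row_free mxrank0 /=.
  by rewrite eqxx.
have [s hs gs] := interval_injective hg erefl gr0.
exact: (indecomposable_retract Iind (interval_nonzero (ltn_ord r) (ltn_ord r)) hg hs gs).
Qed.

(** In [a, b+1) the vector at [b - 1] is the image of the one at [b], where [a, b)
    vanishes; so a map back to [a, b) kills it. *)
Lemma not_section_extend a b W (v : family W (interval_rep a b))
    (u : family (interval_rep a b) W) :
    (a < b)%N -> (b < n)%N -> is_hom v -> (forall r, u r *m v r = 1%:M) ->
  ~ is_section (M := W) (N := interval_rep a b.+1) (fun r => v r *m interval_map a b a b.+1 r).
Proof.
move=> ltab ltbn hv uv [_ [l [hl vcl]]].
have lt0b : (0 < b)%N by exact: leq_ltn_trans ltab.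
have [|ar e] := @arrow_from n (Ordinal ltbn); first by [].
have es : src ar = b :> nat by rewrite e.
have et : (tgt ar).+1 = b by rewrite -srcE es.
pose t := tgt ar.
have cl : interval_map a b a b.+1 t *m (l t *m v t) = 1%:M.
  by rewrite -[LHS]mul1mx -(uv t) !mulmxA -(mulmxA (u t)) -(mulmxA (u t)) vcl mulmx1.
have hlv : is_hom (M := interval_rep a b.+1) (N := interval_rep a b)
    (fun r => l r *m v r).
  exact: hom_comp.
have tin : (a <= t < b)%N by rewrite -ltnS et ltab -et ltnS leqnn.
have dt : dimv (interval_rep a b) t = 1%N by rewrite /= tin.
have ltv0 : rmap (interval_rep a b.+1) ar *m (l t *m v t) = 0.
  rewrite hlv [rmap _ ar](_ : _ = 0) ?mulmx0 //; apply/matrixP=> x.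
  by have := ord_bool x; rewrite es ltnn andbF.
have : interval_map a b a b.+1 t =
    (const_mx 1 : 'M_(_, dimv (interval_rep a b.+1) (src ar)))
      *m rmap (interval_rep a b.+1) ar.
  by rewrite ones_mul // => _ _; rewrite /= es ltnSn ltnW.
move=> emap; move: cl; rewrite emap -mulmxA ltv0 mulmx0 => /(congr1 mxrank).
by rewrite mxrank0 mxrank1 dt.
Qed.

(** The quotient kills the socle. *)
Lemma not_section_quotient a b W (v : family W (interval_rep a b))
    (u : family (interval_rep a b) W) :
    (a < b)%N -> (b <= n)%N -> (forall r, u r *m v r = 1%:M) ->
  ~ is_section (M := W) (N := interval_rep a.+1 b) (fun r => v r *m interval_map a b a.+1 b r).
Proof.
move=> ltab lebn uv [_ [l [hl vcl]]].
pose t := Ordinal (leq_trans ltab lebn).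
have cl : interval_map a b a.+1 b t *m (l t *m v t) = 1%:M.
  by rewrite -[LHS]mul1mx -(uv t) !mulmxA -(mulmxA (u t)) -(mulmxA (u t)) vcl mulmx1.
have := mxrankM_maxl (interval_map a b a.+1 b t) (l t *m v t).
rewrite cl mxrank1 => /leq_trans/(_ (rank_leq_col _)) /=.
by rewrite leqnn ltab ltnn.
Qed.

(** Let [y] be the image in [E] of the vector of [W] at [a].  If [b = n], or if [y]
    is not the image of a vector of [E] at [b], then some functional makes [f] a
    section.  So [y] comes from a vector at [b]; its image in [V] dies at [a] and
    defines a map from [a+1, b+1) to [V].  Conversely the map from [W] to
    [a+1, b+1) through [a, b+1) equals the one through [a+1, b); extending
    both halves to [E], the difference of the two composites kills [W] and
    defines a map from [V] to [a+1, b+1).  The composite of the two maps is the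
    identity. *)
Lemma almost_split_interval a b V W E (f : family W E) (g : family E V) :
    (a < b)%N -> (b <= n)%N -> almost_split f g -> rep_iso W (interval_rep a b) ->
  (b < n)%N /\ rep_iso V (interval_rep a.+1 b.+1).
Proof.
move=> ltab lebn [[_ Vind] [[hf ffree] [hg gfull] fg] [fsec _] left _].
move=> [v [u [hv hu vu uv]]].
pose p := Ordinal (leq_trans ltab lebn).
pose h : family (interval_rep a b) E := fun r => u r *m f r.
have hh : is_hom h by exact: hom_comp.
have hsec (g0 : family E (interval_rep a b)) : is_hom g0 -> ~ forall r, h r *m g0 r = 1%:M.
  move=> hg0 hg01; apply: fsec; split=> //; exists (fun r => g0 r *m u r).
  split=> [|r]; first exact: hom_comp.
  have -> : f r = v r *m h r by rewrite mulmxA vu mul1mx.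
  by rewrite mulmxA -(mulmxA (v r)) hg01 mulmx1 vu.
have hp0 : h p != 0.
  have dp : dimv (interval_rep a b) p = 1%N by rewrite /= leqnn ltab.
  apply/negP=> /eqP hp0; have u0 : u p = 0.
    by apply: (row_free_inj (ffree p)); rewrite mul0mx -/(h p).
  by have := congr1 mxrank (uv p); rewrite u0 mul0mx mxrank0 mxrank1 dp.
have [ltbn|gebn] := ltnP b n; last first.
  have ebn : b = n by apply/eqP; rewrite eqn_leq lebn.
  have hinj : exists2 g0 : family E (interval_rep a b), is_hom g0 &
      forall r, h r *m g0 r = 1%:M.
    by clear -hh hp0 ebn; subst b; exact: (@interval_injective _ _ _ a p).
  by case: hinj => g0 hg0 /(hsec _ hg0).
split=> //; pose q := Ordinal ltbn.
have [Z Zq Zm] := @push_forward _ _ E q _ 1%:M.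
have /submxP[t ht] : ((const_mx 1 : 'rV_(_)) *m h p <= Z p)%MS.
  apply/negPn/negP => /separating_functional[l hl Zl].
  have [|g0 hg0 /(hsec _ hg0)//] := section_of_functional hh (erefl : p = a :> nat) hl.
  by move=> q' eq'; have -> : q' = q by [apply: val_inj]; exists Z.
pose w r := t *m Z r.
have wp : w p = const_mx 1 *m h p by [].
have wm (ar : arrow An) : (src ar <= b)%N -> w (src ar) *m rmap E ar = w (tgt ar).
  by move=> leb; rewrite -mulmxA Zm.
have fg0 r : f r *m g r = 0.
  by apply/sub_kermxP; have /andP[] := fg r.
have hpsi : is_hom (M := interval_rep a.+1 b.+1) (N := V) (fun r => const_mx 1 *m (w r *m g r)).
  apply: vec_hom => ar /andP[leas]; rewrite ltnS => lesb.
  rewrite -mulmxA -hg mulmxA wm //; case: ifP => // /negbT; rewrite -leqNgt => leta.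
  have -> : tgt ar = p by apply/val_inj/eqP; rewrite eqn_leq leta -ltnS -srcE.
  by rewrite wp -!mulmxA fg0 !mulmx0.
have [h1 [hh1 fh1]] := left _ _
  (hom_comp hv (@interval_map_hom k n _ _ _ _ (leqnn a) (leqnSn b)))
  (not_section_extend ltab ltbn hv uv).
have [h2 [hh2 fh2]] := left _ _
  (hom_comp hv (@interval_map_hom k n _ _ _ _ (leqnSn a) (leqnn b)))
  (not_section_quotient ltab lebn uv).
pose C := interval_rep a.+1 b.+1.
(* The difference of the two composites from [E] to [a+1, b+1). *)
pose phi0 : family E C := fun r => h1 r *m interval_map a b.+1 a.+1 b.+1 r
  - h2 r *m interval_map a.+1 b a.+1 b.+1 r.
have hphi0 : is_hom phi0.
  have H1 := hom_comp hh1 (@interval_map_hom k n _ _ _ _ (leqnSn a) (leqnn b.+1)).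
  have H2 := hom_comp hh2 (@interval_map_hom k n _ _ _ _ (leqnn a.+1) (leqnSn b)).
  by move=> ar; rewrite /phi0 mulmxBr mulmxBl H1 H2.
have fphi0 r : f r *m phi0 r = 0.
  rewrite mulmxBr !mulmxA fh1 fh2 -!mulmxA !interval_map_comp ?subrr //.
pose phi : family V C := fun r => pinvmx (g r) *m phi0 r.
have gphi r : g r *m phi r = phi0 r.
  apply/eqP; rewrite -subr_eq0 -opprB oppr_eq0 -{1}[phi0 r]mul1mx mulmxA -mulmxBl.
  have : (1%:M - g r *m pinvmx (g r) <= f r)%MS.
    have /andP[_ /(submx_trans _)] := fg r; apply; apply/sub_kermxP.
    by rewrite mulmxBl mul1mx mulmxKpV ?subrr.
  by case/submxP=> D ->; rewrite -mulmxA fphi0 mulmx0.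
have hphi : is_hom phi.
  move=> ar; apply: (row_full_inj (gfull (src ar))).
  by rewrite mulmxA -hg -mulmxA gphi hphi0 mulmxA gphi.
apply: (indecomposable_retract Vind _ hpsi hphi).
  by apply: interval_nonzero => //; exact: leq_ltn_trans ltab ltbn.
(* The pairing is moved down to the socle, where the vector comes from [W] and
   [h1] extends the inclusion of [W]. *)
have h1_key : w q *m (h1 q *m const_mx 1) = 1%:M :> 'M_1.
  rewrite (@pairing_const _ _ E _ _ a b.+1 w
    (fun r => h1 r *m const_mx 1) _ _ p q) //=; first last.
  - exact: ltnW.
  - by move=> ar leat ltsb; rewrite (hom_covec hh1) // leat /= ltnW // -srcE.
  - by move=> ar _; rewrite ltnS; exact: wm.
  rewrite wp !mulmxA -(mulmxA (const_mx 1)) -(mulmxA (const_mx 1)) -!mulmxA.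
  rewrite (mulmxA (f p)) fh1 !mulmxA -(mulmxA (const_mx 1) (u p)) uv mulmx1.
  rewrite /interval_map !ones_mul /= ?leqnn ?ltab ?ltnS ?(ltnW ltab) //.
  exact: ones_full true.
have phi0_q : phi0 q *m const_mx 1 = h1 q *m const_mx 1 :> 'cV_(_).
  rewrite mulmxBl -!mulmxA [X in _ - _ *m X](_ : _ = 0).
    rewrite mulmx0 subr0 ones_mul //= => _ _; by rewrite ltnSn ltab.
  by apply/matrixP=> x; have := ord_bool x; rewrite ltnn andbF.
move=> r; apply/row_matrixP => i.
have /andP[ltar lerb] : (a.+1 <= r < b.+1)%N by exact: ord_bool i.
have key : w r *m (phi0 r *m const_mx 1) = 1%:M :> 'M_1.
  rewrite -h1_key -phi0_q; apply: esym.
  apply: (@pairing_const _ _ E _ _ a.+1 b.+1 w (fun r => phi0 r *m const_mx 1)) => //.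
  - by move=> ar _; rewrite ltnS; exact: wm.
  - by move=> ar leat ltsb; rewrite (hom_covec hphi0) // leat /= ltnW // -srcE.
have ephi : phi0 r = (phi0 r *m (const_mx 1 : 'cV_(_))) *m (const_mx 1 : 'rV_(_)).
  by rewrite -mulmxA ones_id mulmx1.
by rewrite -mulmxA -(mulmxA (w r)) gphi ephi (mulmxA (w r)) key mul1mx ones_id.
Qed.

End AR.

(** * The objects (i, j) *)

Section Orbit.
Variables (k : fieldType) (n : nat).
Local Notation An := (linear_quiver n).
Local Notation interval_rep := (interval_rep k n).
Implicit Types (V W : rep k An) (M N L : cobj k An) (a b i j : nat).

Lemma ciso_sym M N : ciso M N -> ciso N M.
Proof. by move=> [i1 e1]; split; [exact: rep_iso_sym | exact: esym]. Qed.

Lemma ciso_trans N M L : ciso M N -> ciso N L -> ciso M L.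
Proof. by move=> [i1 e1] [i2 e2]; split; [exact: rep_iso_trans i1 i2 | rewrite e1]. Qed.

Lemma proj_shift_not_module r : ~ is_module (proj_shift k An r).
Proof. by move/ffunP/(_ r); rewrite !ffunE eqxx. Qed.

(** At [b = n] the interval is the injective at its socle, whose inverse
    translate is a shifted projective. *)
Lemma tau_inv_interval a b M N : (a < b)%N -> (b <= n)%N ->
    is_tau M N -> ciso N (of_mod (interval_rep a b)) ->
  if (b < n)%N then exists V,
    [/\ M = of_mod V, indecomposable V & rep_iso V (interval_rep a.+1 b.+1)]
  else exists r, M = proj_shift k An r.
Proof.
move=> ltab lebn; case=> [V W E f g fg|r P Pr|r I Ir] [/= isoN shN].
- have [-> isoV] := almost_split_interval ltab lebn fg isoN.
  by exists V; split=> //; case: fg => [[]].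
- by case: (@proj_shift_not_module r).
- have := rep_iso_trans (rep_iso_sym (inj_at_interval Ir)) isoN.
  case: ifP => [ltbn|]; last by exists r.
  have n0 : (n.-1 < n)%N by rewrite prednK // (leq_ltn_trans _ ltbn).
  move/rep_iso_dim/(_ (Ordinal n0)) => /=.
  have -> : (r <= n.-1)%N by rewrite -ltnS (ltn_predK n0).
  by rewrite n0 andbC ltnNge -ltnS (ltn_predK n0) ltbn.
Qed.

Variables (T : nat -> nat -> cobj k An) (hT : tau_orbit_indexing T).

Lemma orbit_interval i j : (0 < j)%N -> (i + j <= n)%N ->
  ciso (T i j) (of_mod (interval_rep i (i + j))) /\
  indecomposable (interval_rep i (i + j)).
Proof.
elim: i => [|i IH] j0 leijn.
  have lt_n : (j.-1 < n)%N by rewrite prednK.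
  have [P Pj isoT] := indexing_proj hT (Ordinal lt_n).
  have := proj_at_interval Pj; case: Pj => Pind _ _ /=.
  rewrite /= prednK // in isoT * => isoP; split.
    by apply: ciso_trans isoT _; split.
  exact: indecomposable_iso isoP Pind.
have leijn' : (i + j <= n)%N by rewrite ltnW.
have [isoN _] := IH j0 leijn'.
have [||M [N [isoTM isoTN MN]]] := indexing_tau hT (i := i) (j := j).
- by rewrite j0 (leq_trans (leq_addl i j)).
- by rewrite addn1 ltnS leq_subRL ?[(j + i)%N]addnC // (leq_trans (leq_addl i j)).
have := tau_inv_interval _ leijn' MN (ciso_trans (ciso_sym isoTN) isoN).
rewrite -[X in (X < _)%N]addn0 ltn_add2l j0 leijn => /(_ isT) [V [eM Vind isoV]].
split; last exact: indecomposable_iso isoV Vind.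
by apply: ciso_trans isoTM _; rewrite eM; split.
Qed.

Lemma orbit_last i j : (0 < j)%N -> (i + j)%N = n -> ~ is_module (T i.+1 j).
Proof.
move=> j0 eijn; have [isoN _] := @orbit_interval i j j0 (eq_leq eijn).
have [||M [N [isoTM isoTN MN]]] := indexing_tau hT (i := i) (j := j).
- by rewrite j0 -eijn leq_addl.
- by rewrite -eijn addnK addn1.
have := tau_inv_interval _ (eq_leq eijn) MN (ciso_trans (ciso_sym isoTN) isoN).
rewrite -[X in (X < _)%N]addn0 ltn_add2l j0 eijn ltnn => /(_ isT) [r eM].
by case: isoTM => _ eT; rewrite /is_module eT eM; exact: proj_shift_not_module.
Qed.

Lemma orbit_dim i j r : (i + j <= n)%N -> cdim (T i j) r = (i <= r < i + j)%N.
Proof.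
case: j => [|j] leijn; last first.
  by have [[/rep_iso_dim/(_ r)]] := @orbit_interval i j.+1 isT leijn.
have [/rep_iso_dim/(_ r)] := indexing_zero hT i; rewrite /cdim => -> _ /=.
by rewrite addn0 leqNgt andNb.
Qed.

End Orbit.

(** * The exchange relation and continuants *)

Section IntervalChar.
Variables (K : fieldType) (x y z : nat -> K).

(** The index [m] is the submodule [a, m).  The variables [x] are shifted by one:
    [x m] is the one of the vertex before [m] and [x m.+1] the one of [m]. *)
Definition interval_sum a b : K :=
  \sum_(a <= m < b.+1)
    (\prod_(a <= r < m) y r) * (\prod_(m <= r < b) z r) / (x m * x m.+1).

Definition interval_char a b : K := x a * x b.+1 * interval_sum a b.

(** A submodule of [a, b) is either a submodule of [a, c), or contains
    [a, c] and is given by a submodule of the quotient. *)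
Lemma interval_sum_split a c b : (a <= c)%N -> (c < b)%N ->
  interval_sum a b = interval_sum a c * (\prod_(c <= r < b) z r)
    + (\prod_(a <= r < c.+1) y r) * interval_sum c.+1 b.
Proof.
move=> leac ltcb; rewrite /interval_sum (@big_cat_nat _ _ _ c.+1) /=; last 2 first.
- exact: leqW.
- by rewrite ltnS ltnW.
rewrite mulr_suml mulr_sumr; congr (_ + _); apply: eq_big_nat => m /andP[leam lemc].
  rewrite (@big_cat_nat _ _ _ c m b) //=; last exact: ltnW.
  by ring.
rewrite (@big_cat_nat _ _ _ c.+1 a m) ?(leqW leac) //=; ring.
Qed.

(** Cut the intervals that start at [a] after [c], and the interval from [c+1] to
    [d] after [b]. *)
Lemma interval_char_exchange a c b d : (a <= c)%N -> (c < b)%N -> (b < d)%N ->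
  interval_char a b * interval_char c.+1 d =
  interval_char c.+1 b * interval_char a d
  + interval_char a c * interval_char b.+1 d
    * (\prod_(c <= r < b) z r) * (\prod_(c.+1 <= r < b.+1) y r).
Proof.
move=> leac ltcb ltbd; rewrite /interval_char.
rewrite (@interval_sum_split a c b) // (@interval_sum_split a c d) ?(ltn_trans ltcb) //.
rewrite (@interval_sum_split c.+1 b d) //.
rewrite (@big_cat_nat _ _ _ b c d) ?(ltnW ltcb) ?(ltnW ltbd) //=.
ring.
Qed.

Hypothesis x0 : forall m, x m != 0.

Lemma interval_char_empty a : interval_char a a = 1.
Proof.
rewrite /interval_char /interval_sum big_nat1 !big_geq // !mul1r mulfV //.
by rewrite mulf_neq0.
Qed.

Lemma interval_char_extend a b : (a < b)%N ->
  interval_char a b * interval_char b b.+1 =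
  interval_char a b.+1 + interval_char a b.-1 * z b.-1 * y b.
Proof.
case: b => // b ltab /=; rewrite (@interval_char_exchange a b b.+1 b.+2) //.
by rewrite !interval_char_empty !big_nat1 mul1r mulr1.
Qed.

End IntervalChar.

Section Tridiagonal.
Variables (K : comNzRingType) (d u l : nat -> K).

Definition tridiagonal_entry (a b : nat) : K :=
  if a == b then d a else if b == a.+1 then u a
  else if a == b.+1 then l b else 0.

Definition tridiagonal m : 'M[K]_m := \matrix_(a < m, b < m) tridiagonal_entry a b.

Lemma tridiagonal_entry_far a b : (a.+1 < b)%N || (b.+1 < a)%N -> tridiagonal_entry a b = 0.
Proof. by rewrite /tridiagonal_entry => far; rewrite !ifF //; lia. Qed.

Lemma bump_small h a : (a < h)%N -> bump h a = a.
Proof. by move=> ltah; rewrite /bump leqNgt ltah. Qed.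

(** Expand along the last row, which has two nonzero entries; the minor of the
    second one has a single nonzero entry in its last column. *)
Lemma det_tridiagonal_rec m : \det (tridiagonal m.+2) =
  d m.+1 * \det (tridiagonal m.+1) - u m * l m * \det (tridiagonal m).
Proof.
have bump_m : bump m m = m.+1 by rewrite /bump leqnn.
rewrite (expand_det_row _ ord_max) big_ord_recr big_ord_recr /= big1 ?add0r; last first.
  by move=> j _; rewrite mxE tridiagonal_entry_far ?mul0r //= ltnS ltn_ord orbT.
rewrite addrC; congr (_ + _).
  rewrite mxE /= {1}/tridiagonal_entry eqxx /cofactor -signr_odd oddD addbb mul1r.
  congr (_ * \det _).
  by apply/matrixP => a b; rewrite !mxE /= !bump_small.
rewrite mxE /= {1}/tridiagonal_entry gtn_eqF // ltn_eqF // eqxx.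
rewrite /cofactor -signr_odd /= oddD addbb /= mulN1r mulrN mulrAC mulrC.
congr (- (_ * _)); rewrite mulrC.
rewrite (expand_det_col _ ord_max) big_ord_recr /= big1 ?add0r; last first.
  move=> j _; rewrite !mxE /= bump_m bump_small ?(ltn_trans (ltn_ord j)) //.
  by rewrite tridiagonal_entry_far ?mul0r // ltnS ltn_ord.
rewrite !mxE /= bump_m bump_small // {1}/tridiagonal_entry ltn_eqF // eqxx mulrC.
rewrite /cofactor -signr_odd oddD addbb mul1r; congr (\det _ * _).
apply/matrixP => a b; rewrite !mxE /= !(@bump_small m) // bump_small //.
exact: ltn_trans (ltn_ord a) _.
Qed.

Lemma continuant_det (c : nat -> K) :
    c 0 = 1 -> c 1 = d 0 ->
    (forall m, c m.+2 = d m.+1 * c m.+1 - u m * l m * c m) ->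
  forall m, c m = \det (tridiagonal m).
Proof.
move=> c0 c1 cSS m.
suff [] : c m = \det (tridiagonal m) /\ c m.+1 = \det (tridiagonal m.+1) by [].
elim: m => [|m [IH0 IH1]]; first by rewrite c0 c1 det_mx00 det_mx11 mxE.
by split=> //; rewrite cSS det_tridiagonal_rec IH0 IH1.
Qed.

End Tridiagonal.

(** * Quiver Grassmannians of interval modules *)

Section Constructible.
Variable k : fieldType.
Implicit Types I J : finType.

Lemma peval_const I (c : k) (x : affine k I) : peval (c%:MP_[#|I|]) x = c.
Proof. exact: mevalC. Qed.

Lemma peval_var I (i : I) (x : affine k I) : peval ('X_(enum_rank i)) x = x i.
Proof. by rewrite /peval mevalXU enum_rankK. Qed.

Lemma constructible_True I : constructible (fun _ : affine k I => True).
Proof.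
apply: constructible_ext (constructible_zeros (0 : {mpoly k[#|I|]})) => x.
by rewrite /peval meval0.
Qed.

Lemma constructible_singleton I (pt : affine k I) : constructible (fun x => x = pt).
Proof.
have H (s : seq I) : constructible (fun x : affine k I => forall i, i \in s -> x i = pt i).
  elim: s => [|i s IH]; first by apply: constructible_ext (constructible_True I) => x.
  apply: constructible_ext (constructible_inter
    (constructible_zeros ('X_(enum_rank i) - (pt i)%:MP)) IH) => x.
  have -> : peval ('X_(enum_rank i) - (pt i)%:MP) x = x i - pt i.
    by rewrite -[in RHS](peval_var i x) /peval mevalB mevalC.
  split=> [[/eqP + H] j|H].
    by rewrite subr_eq0 inE => /eqP ei /predU1P[->|/H].
  split; first by rewrite H ?mem_head // subrr.
  by move=> j js; apply: H; rewrite inE js orbT.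
apply: constructible_ext (H (enum I)) => x; split=> [e|-> //].
by apply/ffunP => i; apply: e; rewrite mem_enum.
Qed.

Lemma constructible_empty I (A : affine k I -> Prop) : (forall x, ~ A x) -> constructible A.
Proof.
move=> A0; apply: constructible_ext (constructible_compl (constructible_True I)) => x.
by split=> [/(_ Logic.I)|/A0].
Qed.

Variable chi : forall I : finType, (affine k I -> Prop) -> int.
Hypothesis hchi : euler_characteristic chi.

Lemma chi_ext I (A B : affine k I -> Prop) :
  constructible A -> (forall x, A x <-> B x) -> chi A = chi B.
Proof.
move=> cA AB; have cB := constructible_ext AB cA.
have pmap_id x : pmap (fun i : I => 'X_(enum_rank i)) x = x :> affine k I.
  by apply/ffunP=> i; rewrite ffunE peval_var.
by apply: (chi_isomorphism hchi cA cB (f := fun i => 'X_(enum_rank i))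
  (g := fun i => 'X_(enum_rank i))) => x Ax; rewrite !pmap_id; split=> //; apply/AB.
Qed.

(** Additivity for the disjoint union of the empty set with itself. *)
Lemma chi_empty I (A : affine k I -> Prop) : (forall x, ~ A x) -> chi A = 0.
Proof.
move=> A0; have cA := constructible_empty A0.
apply: (addrI (chi A)); rewrite addr0 -(chi_additive hchi cA cA); last by move=> x /A0.
apply: chi_ext => [|x]; last by split=> [[] //|]; left.
by apply: constructible_empty => x [] /A0.
Qed.

(** The line is the product of the line with a point, and both lines have
    characteristic 1. *)
Lemma chi_void : chi (fun _ : affine k void => True) = 1.
Proof.
have cT I := constructible_True I.
have := chi_product hchi (cT void) (cT unit); rewrite (chi_line hchi) mulr1 => <-.
rewrite -(chi_line hchi).
have cTT : constructible (fun x : affine k (void + unit)%type =>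
    (fun=> True) (fst_part x) /\ (fun=> True) (snd_part x)).
  by apply: constructible_ext (cT _) => x.
apply: (chi_isomorphism hchi cTT (cT unit)
  (f := fun _ : unit => 'X_(enum_rank (inr tt : void + unit)))
  (g := fun _ : void + unit => 'X_(enum_rank tt))) => x _; split=> //; apply/ffunP.
  by case=> [[]|[]]; rewrite !ffunE peval_var ffunE peval_var.
by case; rewrite !ffunE peval_var ffunE peval_var.
Qed.

Lemma chi_singleton I (pt : affine k I) : chi (fun x => x = pt) = 1.
Proof.
rewrite -chi_void; apply: (chi_isomorphism hchi
  (f := fun v : void => match v with end) (g := fun i => (pt i)%:MP)).
- exact: constructible_singleton.
- exact: constructible_True.
- move=> x ->; split=> //; apply/ffunP=> i; by rewrite ffunE peval_const.
move=> y _; split; first by apply/ffunP=> i; rewrite ffunE peval_const.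
by apply/ffunP; case.
Qed.

End Constructible.

Section Grassmannian.
Variables (k : fieldType) (n : nat).
Local Notation An := (linear_quiver n).
Local Notation interval_rep := (interval_rep k n).
Implicit Types (a b m : nat) (r s t : 'I_n).

(** In dimension at most 1 an echelon matrix is determined by its rank. *)
Lemma line_subspace (d : bool) (A : 'M[k]_d) (e : nat) : (e <= d)%N ->
  reduced_echelon A /\ \rank A = e <-> A = const_mx e%:R.
Proof.
case: d A => A led; last first.
  move: led; rewrite leqn0 => /eqP ->; split=> _; first by apply/matrixP=> -[].
  split=> [[]//|]; by apply/eqP; rewrite -leqn0 rank_leq_row.
have c1 : const_mx 1 = 1%:M :> 'M[k]_1 by exact: (ones_full k true).
have c0 : const_mx 0 = 0 :> 'M[k]_1 by apply/matrixP=> i j; rewrite !mxE.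
case: e led => [|[|//]] _; split.
- by case=> _ /eqP; rewrite mxrank_eq0 => /eqP ->; apply/matrixP=> i j; rewrite !mxE.
- move=> ->; rewrite c0 mxrank0; split=> // i.
  by left=> j; rewrite mxE.
- case=> Aech rA; rewrite c1; case: (Aech ord0) => [A0|[A1 _ _]].
    have A00 : A = 0 by apply/matrixP=> i j; rewrite !ord1 A0 mxE.
    by move: rA; rewrite A00 mxrank0.
  by apply/matrixP=> i j; rewrite !ord1 A1 mxE.
- move=> ->; rewrite c1 mxrank1; split=> // i; right; rewrite !ord1; split.
  + by rewrite mxE.
  + by case; case.
  + by move=> l; rewrite (ord1 l).
Qed.

Lemma line_subspace_sub (d d' : bool) (e e' : nat) : (e <= d)%N -> (e' <= d')%N ->
  ((const_mx e%:R : 'M[k]_d) *m (const_mx 1 : 'M_(d, d')) <= (const_mx e'%:R : 'M[k]_d'))%MS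
  = d && d' ==> (e <= e')%N.
Proof.
case: d => /=; last by move=> _ _; rewrite [X in (X <= _)%MS]flatmx0 sub0mx.
case: d' => /=; last by move=> _ _; rewrite [X in (X <= _)%MS]thinmx0 sub0mx.
have c1 : const_mx 1 = 1%:M :> 'M[k]_1 by exact: (ones_full k true).
have c0 : const_mx 0 = 0 :> 'M[k]_1 by apply/matrixP=> i j; rewrite !mxE.
case: e => [|[|//]] _; first by rewrite c0 mul0mx sub0mx.
case: e' => [|[|//]] _; last by rewrite c1 mulmx1 submx_refl.
by rewrite c1 mulmx1 c0 submx0 -mxrank_eq0 mxrank1.
Qed.

(** A subspace of an interval module is a set of vertices of the support; it is a
    submodule when it is closed under the arrows. *)
Definition submodule_dim a b (e : 'I_n -> nat) : bool :=
  [forall ar : arrow An, (a <= tgt ar)%N && (src ar < b)%N ==> (e (src ar) <= e (tgt ar))%N].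

(** At each vertex the subspace has dimension 0 or 1, so its matrix is forced by
    [e]; the condition at the arrows then only depends on [e]. *)
Lemma interval_grassmannian a b (e : 'I_n -> nat)
    (x : affine k (entry_index (interval_rep a b))) :
    (forall r, (e r <= dimv (interval_rep a b) r)%N) ->
  quiver_grassmannian e x <->
  x = [ffun t => (e (tag t))%:R] /\ submodule_dim a b e.
Proof.
move=> led.
have step (v : affine k (entry_index (interval_rep a b))) ar :
   (subspace_at v (src ar) = const_mx (e (src ar))%:R) ->
   (subspace_at v (tgt ar) = const_mx (e (tgt ar))%:R) ->
  (subspace_at v (src ar) *m rmap (interval_rep a b) ar <= subspace_at v (tgt ar))%MS
    = ((a <= tgt ar)%N && (src ar < b)%N ==> (e (src ar) <= e (tgt ar))%N).
  move=> -> ->; rewrite line_subspace_sub ?led //; congr (_ ==> _).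
  rewrite srcE; case: (leqP a (tgt ar)) => [leat|]; last by rewrite /= andbF.
  rewrite leqW //=; case: (ltnP (tgt ar).+1 b) => //= h; by rewrite ltnW.
split=> [[gr1 gr2]|[-> /forallP sub]].
  have pt r : subspace_at x r = const_mx (e r)%:R by apply/line_subspace/gr1/led.
  split; last by apply/forallP=> ar; rewrite -(step x).
  apply/ffunP=> -[r [i j]]; rewrite ffunE /=.
  by have /matrixP/(_ i j) := pt r; rewrite !mxE.
set x0 := [ffun _ => _].
have pt r : subspace_at x0 r = const_mx (e r)%:R by apply/matrixP=> i j; rewrite !mxE ffunE.
split=> [r|ar]; first by apply/line_subspace; [exact: led | exact: pt].
by rewrite step ?pt //; exact: sub.
Qed.

End Grassmannian.

(** * The cluster character of an interval module *)

Section Monomials.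
Variable K : fieldType.

Lemma prod_indicator (G : nat -> K) lo hi N : (hi <= N)%N ->
  \prod_(r < N) G r ^ ((lo <= r < hi)%N : nat)%:Z = \prod_(lo <= r < hi) G r.
Proof.
move=> lehiN; rewrite (big_nat_widen _ _ _ _ _ lehiN) (big_nat_widenl _ _ _ _ _ (leq0n lo)).
rewrite big_mkord [RHS]big_mkcond /=; apply: eq_bigr => r _; rewrite andbC.
by case: ifP => _; rewrite ?expr1z ?expr0z.
Qed.

Lemma prod_shift_telescope (G : nat -> K) lo hi : (forall r, G r != 0) -> (lo <= hi)%N ->
  \prod_(lo <= r < hi) G r / \prod_(lo <= r < hi) G r.+1 = G lo / G hi.
Proof.
move=> G0 /subnKC <-; elim: (hi - lo)%N => [|d IH].
  by rewrite addn0 !big_geq // !divff // oner_neq0.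
rewrite addnS !big_nat_recr ?leq_addr //=.
by rewrite invfM mulrACA IH mulrA divfK.
Qed.

End Monomials.

Section Formula.
Variable n : nat.
Local Notation An := (linear_quiver n).
Implicit Types (a b m : nat) (r s t : 'I_n).

(** At most one arrow ends at [r], and it starts at [r + 1]; the hypothesis on
    [g n] accounts for the last vertex, at which no arrow ends. *)
Lemma sum_arrow_into (g : nat -> int) r : g n = 0 ->
  \sum_(ar : arrow An) g (src ar) * simple_dim r (tgt ar) = g r.+1.
Proof.
move=> gn; have [ltrn|] := ltnP r.+1 n; last first.
  move=> lenr; have -> : r.+1 = n by apply/eqP; rewrite eqn_leq lenr ltn_ord.
  rewrite gn big1 // => ar _; rewrite /simple_dim; case: eqP => [e|_]; last by rewrite mulr0.
  by have := ltn_ord (src ar); rewrite srcE e ltnNge lenr.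
have [ar e] := arrow_to ltrn.
rewrite (bigD1 ar) // big1.
  by rewrite /simple_dim srcE e eqxx /= addr0 mulr1.
move=> ar' ne; rewrite /simple_dim -e; case: eqP => [/tgt_inj e'|_]; last by rewrite mulr0.
by rewrite e' eqxx in ne.
Qed.

(** At most one arrow starts at [r], and it ends at [r - 1]; the shift of [g]
    avoids naming a predecessor of the vertex 0. *)
Lemma sum_arrow_from (g : nat -> int) r : g 0%N = 0 ->
  \sum_(ar : arrow An) simple_dim r (src ar) * g (tgt ar).+1 = g r.
Proof.
move=> g0; have [r0|r0] := posnP r.
  rewrite r0 g0 big1 // => ar _; rewrite /simple_dim; case: eqP => [e|_]; last by rewrite mul0r.
  by have := srcE ar; rewrite e r0.
have [ar e] := arrow_from r0.
rewrite (bigD1 ar) // big1.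
  by rewrite /simple_dim -srcE e eqxx /= addr0 mul1r.
move=> ar' ne; rewrite /simple_dim -e; case: eqP => [e'|_]; last by rewrite mul0r.
have/tgt_inj e'' : tgt ar' = tgt ar.
  by apply/val_inj/succn_inj; rewrite /= -!srcE e'.
by rewrite e'' eqxx in ne.
Qed.

Lemma sum_simple (f : 'I_n -> int) r : \sum_(s < n) f s * simple_dim r s = f r.
Proof.
rewrite (bigD1 r) //= big1 ?addr0; first by rewrite /simple_dim eqxx mulr1.
by move=> s ne; rewrite /simple_dim (negPf ne) mulr0.
Qed.

(** [xpad m] is the variable x_m, vertices being counted from 1, with the value 1
    at m = 0 and m = n + 1. *)
Definition xpad (s : nat) : coef_field n :=
  if s is r.+1 then oapp (@xvar n) 1 (insub r) else 1.

Arguments xpad : simpl never.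

Lemma var_neq0 (i : 'I_(n + n + n)) : tofrac ('X_i : {mpoly rat[n + n + n]}) != 0.
Proof.
rewrite tofrac_eq0; apply/eqP => /(congr1 (meval (fun=> 1))).
by rewrite mevalXU meval0 => /eqP; rewrite oner_eq0.
Qed.

Lemma xpad_neq0 m : xpad m != 0.
Proof.
case: m => [|m]; first exact: oner_neq0.
rewrite /xpad.
by case: insub => [r|] /=; [exact: var_neq0 | exact: oner_neq0].
Qed.

Lemma xpad_ord r : xpad r.+1 = xvar r.
Proof. by rewrite /xpad -[nat_of_ord r]/(val r) valK. Qed.

Lemma xpad_last : xpad n.+1 = 1.
Proof. by rewrite /xpad insubF ?ltnn. Qed.

Lemma at_vertex_ord F r : at_vertex F r.+1 = F r.
Proof.
rewrite /at_vertex; case: pickP => [s /eqP e|/(_ r)]; last by rewrite eqxx.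
by congr F; apply: val_inj; move: e => /= [].
Qed.

Local Notation yat := (fun l : nat => at_vertex (@yvar n) l.+1).
Local Notation zat := (fun l : nat => at_vertex (@zvar n) l.+1).
Local Notation ind lo hi r := (((lo <= r < hi)%N : nat)%:Z : int).

Lemma monomial_indicator F lo hi : (hi <= n)%N ->
  monomial F (fun r => ind lo hi r) = \prod_(lo <= r < hi) at_vertex F r.+1.
Proof.
move=> lehi; rewrite -(prod_indicator _ _ lehi); apply: eq_bigr => r _.
by rewrite at_vertex_ord.
Qed.

(** The four indicator functions in the exponent of x_r are those of two intervals
    and of their translates by one, so that their products telescope. *)
Lemma character_term a m b : (a <= m)%N -> (m <= b)%N -> (b <= n)%N ->
  \prod_(r < n) (xvar r ^ (- euler_form An (fun s => ind a m s) (simple_dim r)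
      - euler_form An (simple_dim r) (fun s => ind m b s))
    * yvar r ^ ind a m r * zvar r ^ ind m b r) =
  xpad a * xpad b.+1 * ((\prod_(a <= r < m) yat r) * (\prod_(m <= r < b) zat r)
    / (xpad m * xpad m.+1)).
Proof.
move=> leam lemb lebn.
have lemn := leq_trans lemb lebn.
have e1 (r : 'I_n) : euler_form An (fun s => ind a m s) (simple_dim r) =
    ind a m r - ind a m r.+1.
  rewrite /euler_form sum_simple; congr (_ - _).
  by apply: (sum_arrow_into (g := fun s : nat => ind a m s)); rewrite ltnNge lemn andbF.
have e2 (r : 'I_n) : euler_form An (simple_dim r) (fun s => ind m b s) =
    ind m b r - ind m.+1 b.+1 r.
  rewrite /euler_form; congr (_ - _).
    by rewrite -[RHS](sum_simple (fun s => ind m b s)); apply: eq_bigr => s _; rewrite mulrC.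
  by rewrite -(sum_arrow_from (g := fun s : nat => ind m.+1 b.+1 s)) //.
transitivity (\prod_(r < n) (xpad r.+1 ^ ind a m r.+1 * (xpad r.+1 ^ ind a m r)^-1
   * (xpad r.+1 ^ ind m.+1 b.+1 r * (xpad r.+1 ^ ind m b r)^-1))
   * (monomial (@yvar n) (fun r => ind a m r) * monomial (@zvar n) (fun r => ind m b r))).
  rewrite -!big_split /=; apply: eq_bigr => r _; rewrite e1 e2 -mulrA; congr (_ * _).
  rewrite !invr_expz -!expfzDr ?xpad_neq0 // xpad_ord; congr (_ ^ _); ring.
rewrite !monomial_indicator //.
rewrite !big_split /= !prodfV.
have -> : \prod_(r < n) xpad r.+1 ^ ind m.+1 b.+1 r = \prod_(m.+1 <= r < b.+1) xpad r.+1.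
  rewrite -(prod_indicator _ _ (lebn : b.+1 <= n.+1)%N) big_ord_recr /= xpad_last.
  by rewrite exp1rz mulr1.
rewrite !(prod_indicator (fun r : nat => xpad r.+1)) //.
have -> : \prod_(r < n) xpad r.+1 ^ ind a m r.+1 = \prod_(a <= r < m) xpad r.
  rewrite -(prod_indicator _ _ (leqW lemn)) big_ord_recl [xpad _](erefl : xpad 0 = 1) exp1rz.
  by rewrite mul1r.
have -> : \prod_(m <= r < b) xpad r.+1 = \prod_(m.+1 <= r < b.+1) xpad r by rewrite big_add1.
have -> : \prod_(m.+1 <= r < b.+1) xpad r.+1 / \prod_(m.+1 <= r < b.+1) xpad r =
    xpad b.+1 / xpad m.+1.
  by rewrite -invf_div prod_shift_telescope ?ltnS //; [rewrite invf_div | exact: xpad_neq0].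
rewrite prod_shift_telescope //; last exact: xpad_neq0.
by rewrite mulf_div [LHS]mulrAC -[LHS]mulrA.
Qed.

Lemma eq_euler_form (d d' e e' : 'I_n -> int) : d =1 d' -> e =1 e' ->
  euler_form An d e = euler_form An d' e'.
Proof.
by move=> dd ee; congr (_ - _); apply: eq_bigr => i _; rewrite dd ee.
Qed.

Section IntervalFormula.
Variables (k : fieldType) (chi : forall I : finType, (affine k I -> Prop) -> int).
Hypothesis hchi : euler_characteristic chi.
Variables (a b : nat).
Hypotheses (leab : (a <= b)%N) (lebn : (b <= n)%N).
Local Notation V := (interval_rep k n a b).

Lemma chi_interval_grassmannian (e : 'I_n -> nat) : (forall r, (e r <= dimv V r)%N) ->
  chi (quiver_grassmannian (V := V) e) = (submodule_dim a b e : nat)%:Z.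
Proof.
move=> led; case: (boolP (submodule_dim a b e)) => sub; last first.
  by apply: (chi_empty hchi) => x /(interval_grassmannian _ led) [_]; apply/negP.
rewrite -[RHS](chi_singleton hchi ([ffun t => (e (tag t))%:R] : affine k (entry_index V))).
apply: esym; apply: (chi_ext hchi (constructible_singleton _)) => x; split.
  by move=> ->; apply/(interval_grassmannian _ led).
by move/(interval_grassmannian _ led) => [].
Qed.

Definition initial_dim (m : nat) : {dffun forall r : 'I_n, 'I_(dimv V r).+1} :=
  [ffun r : 'I_n => inord (a <= r < m)%N : 'I_(dimv V r).+1].

Lemma initial_dimE m r : (m <= b)%N -> initial_dim m r = (a <= r < m)%N :> nat.
Proof.
move=> lemb; rewrite ffunE inordK // ltnS /=.
by case: (leqP a r) => //= _; case: (ltnP r m) => // /leq_trans ->.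
Qed.

(** Interval modules are uniserial.  The end of the initial interval is the least
    [m] from which [e] vanishes. *)
Lemma submodule_dimP (e : {dffun forall r : 'I_n, 'I_(dimv V r).+1}) :
  submodule_dim a b (fun r => e r) =
  (e \in [set initial_dim (a + i)%N | i : 'I_(b - a).+1]).
Proof.
apply/forallP/imsetP => [sub|[i _ -> ar]]; last first.
  apply/implyP => /andP[leat ltsb].
  have leib : (a + i <= b)%N by rewrite -leq_subRL // -ltnS.
  rewrite !initial_dimE // leat /= andbC; case: ltnP => // ltsi.
  by rewrite (ltn_trans _ ltsi) ?srcE // leqW.
have led r : (e r <= (a <= r < b))%N by rewrite -ltnS; exact: (ltn_ord (e r)).
pose vanish m := (a <= m)%N && [forall r : 'I_n, (m <= r)%N ==> (e r == 0 :> nat)].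
have vb : vanish b.
  rewrite /vanish leab; apply/forallP=> r; apply/implyP => lebr.
  by move: (led r); rewrite ltnNge lebr andbF leqn0.
case: (ex_minnP (ex_intro vanish b vb)) => m /andP[leam /forallP vm] minm.
have lemb := minm _ vb.
have ltm : (m - a < (b - a).+1)%N by rewrite ltnS leq_sub2r.
exists (Ordinal ltm) => //=; rewrite subnKC //; apply/ffunP => r.
apply: val_inj; rewrite /= initial_dimE //.
case: (boolP (a <= r < m)%N) => [/andP[lear lerm]|]; last first.
  rewrite negb_and -!ltnNge ltnS => /orP[ltra|lemr]; last exact/eqP/(implyP (vm r)).
  by apply/eqP; rewrite -leqn0 (leq_trans (led r)) // leqn0 leqNgt ltra.
suff e1 : (0 < e r)%N.
  by apply/eqP; rewrite eqn_leq e1 (leq_trans (led r)) ?leq_b1.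
have m0 : (0 < m)%N by exact: leq_ltn_trans lerm.
have ltmn : (m.-1 < n)%N by rewrite prednK // (leq_trans lemb).
pose p := Ordinal ltmn.
(* Otherwise [e] would already vanish from [m - 1] on. *)
have ep : (0 < e p)%N.
  rewrite lt0n; apply/negP => /eqP ep0.
  suff /minm : vanish m.-1 by rewrite -ltnS prednK // ltnn.
  rewrite /vanish -ltnS prednK // (leq_ltn_trans lear lerm) /=.
  apply/forallP => s; apply/implyP; rewrite leq_eqVlt => /predU1P[es|].
    by have -> : s = p by [apply: val_inj]; rewrite ep0.
  by rewrite prednK // => lems; exact: (implyP (vm s)).
have lerp : (r <= p)%N by rewrite /= -ltnS prednK.
move: r lerp lear lerm => {}r; move: r.
apply: (arrow_down (P := fun r => (a <= r)%N -> (r < m)%N -> (0 < e r)%N)) => //.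
move=> ar lesp IH leat lttm.
have ltsm : (src ar < m)%N by rewrite -(prednK m0) ltnS.
apply: leq_trans (IH _ ltsm) _; first by rewrite srcE leqW.
by apply: (implyP (sub ar)); rewrite leat (leq_trans ltsm).
Qed.

Lemma character_formula_interval :
  character_formula chi V = interval_char xpad yat zat a b.
Proof.
pose F (e : {dffun forall r : 'I_n, 'I_(dimv V r).+1}) : coef_field n :=
  \prod_(r < n)
    (xvar r ^ (- euler_form An (fun s => (e s : nat)%:Z) (simple_dim r)
      - euler_form An (simple_dim r) (fun s => (dimv V s)%:Z - (e s : nat)%:Z))
    * yvar r ^ (e r : nat)%:Z * zvar r ^ ((dimv V r)%:Z - (e r : nat)%:Z)).
have leib (i : 'I_(b - a).+1) : (a + i <= b)%N by rewrite -leq_subRL // -ltnS.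
have init_inj : injective (fun i : 'I_(b - a).+1 => initial_dim (a + i)).
  suff lt_neq (i j : 'I_(b - a).+1) : (i < j)%N -> initial_dim (a + i) <> initial_dim (a + j).
    by move=> i j eij; apply: val_inj; case: (ltngtP i j) => // /lt_neq; rewrite eij.
  move=> ltij eij; have lt_n : (a + i < n)%N.
    by rewrite (leq_trans _ lebn) // (leq_trans _ (leib j)) // ltn_add2l.
  have := initial_dimE (Ordinal lt_n) (leib i); rewrite eij initial_dimE //=.
  by rewrite ltnn andbF leq_addr ltn_add2l ltij.
transitivity (\sum_(e in [set initial_dim (a + i)%N | i : 'I_(b - a).+1]) F e).
  rewrite /character_formula [RHS]big_mkcond /=; apply: eq_bigr => e _.
  rewrite (@chi_interval_grassmannian (fun r => e r)) => [|r].
    2: by rewrite -ltnS; exact: (ltn_ord (e r)).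
  by rewrite submodule_dimP; case: (e \in _); rewrite ?mul1r ?mul0r.
rewrite big_imset /=; last by move=> i j _ _; exact: init_inj.
rewrite /interval_char /interval_sum mulr_sumr.
rewrite -[X in \sum_(X <= _ < _) _]add0n big_addn subSn // big_mkord.
apply: eq_big => [i|i _]; first by rewrite inE.
rewrite [(i + a)%N]addnC -character_term ?leq_addr // /F.
have eE r : (initial_dim (a + i) r : nat)%:Z = ind a (a + i) r by rewrite initial_dimE.
have fE r : (dimv V r)%:Z - (initial_dim (a + i) r : nat)%:Z = ind (a + i) b r.
  rewrite eE /=; have := leib i; lia.
by apply: eq_bigr => r _; rewrite fE eE (eq_euler_form eE (frefl _))
  (eq_euler_form (frefl _) fE).
Qed.

End IntervalFormula.

End Formula.

(** * The multiplication formulas *)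

Lemma character_orbit (k : fieldType) (n : nat)
    (chi : forall I : finType, (affine k I -> Prop) -> int)
    (X : cobj k (linear_quiver n) -> coef_field n)
    (T : nat -> nat -> cobj k (linear_quiver n)) :
  euler_characteristic chi -> cluster_character chi X -> tau_orbit_indexing T ->
  forall i j, (i + j <= n)%N ->
  X (T i j) = interval_char (@xpad n) (fun l => at_vertex (@yvar n) l.+1)
    (fun l => at_vertex (@zvar n) l.+1) i (i + j).
Proof.
move=> hchi hX hT i [|j] leijn.
  rewrite addn0 interval_char_empty; last exact: xpad_neq0.
  by rewrite (character_iso hX (indexing_zero hT i)) (character_zero hX).
have [isoT ind] := orbit_interval hT (ltn0Sn j) leijn.
by rewrite (character_iso hX isoT) (character_module hX ind)
  (character_formula_interval hchi) // leq_addr.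
Qed.

Theorem corollary3p2 (k : closedFieldType) (n : nat)
    (chi : forall I : finType, (affine k I -> Prop) -> int)
    (X : cobj k (linear_quiver n) -> coef_field n)
    (T : nat -> nat -> cobj k (linear_quiver n)) :
  euler_characteristic chi ->
  cluster_character chi X ->
  tau_orbit_indexing T ->
  forall i j : nat, (1 <= j <= n)%N -> (0 <= i <= n - j)%N ->
  [/\
    (* (i), the variables z_(i+j) and y_(i+j+1) being those of the vertices
       r = i+j and s = i+j+1 *)
    forall r s : 'I_n, r.+1 = (i + j)%N -> s.+1 = (i + j + 1)%N ->
      X (T i j) * X (T (i + j)%N 1%N) =
      X (T i (j + 1)%N) + X (T i (j - 1)%N) * zvar r * yvar s,
    (* (ii), the dimension vector dim(i+1,j+alpha-1) being that of a module *)
    forall alpha beta : nat,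
      (0 <= beta <= i)%N -> (1 <= alpha)%N -> (i + j + alpha <= n + 1)%N ->
      is_module (T (i + 1)%N (j + alpha - 1)%N) ->
      let u (r : 'I_n) : int :=
        (cdim (T (i - beta)%N (j + beta)%N) r)%:Z
        - (cdim (T (i - beta)%N beta) r)%:Z in
      let v (r : 'I_n) : int :=
        (cdim (T (i + 1)%N (j + alpha - 1)%N) r)%:Z
        - (cdim (T (i + j + 1)%N (alpha - 1)%N) r)%:Z in
      X (T (i - beta)%N (j + beta)%N) * X (T (i + 1)%N (j + alpha - 1)%N) =
      X (T (i + 1)%N (j - 1)%N) * X (T (i - beta)%N (j + alpha + beta)%N)
      + X (T (i - beta)%N beta) * X (T (i + j + 1)%N (alpha - 1)%N)
        * monomial (@zvar n) u * monomial (@yvar n) v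
  & (* (iii) *)
    X (T i j) =
    \det (\matrix_(a < j, b < j)
      if a == b then X (T (i + a)%N 1%N)
      else if b == a.+1 :> nat then at_vertex (@yvar n) (i + a + 2)%N
      else if a == b.+1 :> nat then at_vertex (@zvar n) (i + b + 1)%N
      else 0)].
Proof.
move=> hchi hX hT i j /andP[j0 lejn] /andP[_ leij].
have leijn : (i + j <= n)%N by rewrite addnC -leq_subRL.
pose C := interval_char (@xpad n) (fun l => at_vertex (@yvar n) l.+1)
  (fun l => at_vertex (@zvar n) l.+1).
have XT m l : (m + l <= n)%N -> X (T m l) = C m (m + l)%N.
  exact: (character_orbit hchi hX hT).
have ext a b : (a < b)%N -> C a b * C b b.+1 = C a b.+1
    + C a b.-1 * at_vertex (@zvar n) b.-1.+1 * at_vertex (@yvar n) b.+1.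
  by move=> ltab; rewrite -interval_char_extend //; exact: xpad_neq0.
split.
- move=> r s er es; have lts := ltn_ord s.
  have le1 : (i + j + 1 <= n)%N by rewrite -es.
  rewrite !XT ?addnA //; last by lia.
  rewrite addnBA // subn1 addn1 ext; last by lia.
  by rewrite -er -(at_vertex_ord (@zvar n)) -(at_vertex_ord (@yvar n)) es er addn1.
- move=> alpha beta /andP[_ lebi] a0 le1 Tmod u v.
  (* For i + j + alpha = n + 1 the second factor would be a shifted projective. *)
  have lealn : (i + j + alpha <= n)%N.
    rewrite leqNgt; apply/negP => ltn1; move: Tmod; rewrite [(i + 1)%N]addn1.
    apply: (orbit_last hT); lia.
  have uE r : u r = ((i <= r < i + j)%N : nat)%:Z.
    by rewrite /u !(orbit_dim hT); lia.
  have vE r : v r = ((i.+1 <= r < (i + j).+1)%N : nat)%:Z.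
    by rewrite /v !(orbit_dim hT); lia.
  have -> : monomial (@zvar n) u = \prod_(i <= r < i + j) at_vertex (@zvar n) r.+1.
    by rewrite -monomial_indicator //; apply: eq_bigr => r _; rewrite uE.
  have -> : monomial (@yvar n) v = \prod_(i.+1 <= r < (i + j).+1) at_vertex (@yvar n) r.+1.
    rewrite -monomial_indicator; last by lia.
    by apply: eq_bigr => r _; rewrite vE.
  rewrite !XT; try lia.
  have -> : (i - beta + (j + beta) = i + j)%N by lia.
  have -> : (i + 1 + (j + alpha - 1) = i + j + alpha)%N by lia.
  have -> : (i + 1 + (j - 1) = i + j)%N by lia.
  have -> : (i - beta + (j + alpha + beta) = i + j + alpha)%N by lia.
  have -> : (i - beta + beta = i)%N by lia.
  have -> : (i + j + 1 + (alpha - 1) = i + j + alpha)%N by lia.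
  rewrite !addn1; apply: interval_char_exchange; lia.
pose d a := C (i + a)%N (i + a).+1.
pose y a := at_vertex (@yvar n) (i + a + 2).
pose z a := at_vertex (@zvar n) (i + a + 1).
rewrite XT // (@continuant_det _ d y z (fun m => C i (i + m)%N)).
- congr (\det _); apply/matrixP => a b; rewrite !mxE /tridiagonal_entry -val_eqE /=.
  by rewrite XT /d ?[(i + a + 1)%N]addn1 //; have lta := ltn_ord a; lia.
- by rewrite addn0; apply: interval_char_empty; exact: xpad_neq0.
- by rewrite /d addn0 addn1.
move=> m; rewrite mulrC /d /y /z !addnS addn0 ext; last by lia.
rewrite /= -[X in _ + X - _]mulrA [at_vertex (@yvar n) _ * _]mulrC.
by rewrite [X in _ - X]mulrC addrK.
Qed.
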